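(* Let $\mathbf{u}_0\in\mathcal{V}$. If $D(\mathcal{L})[\mathbf{u}_0]^{-1}$ exists on $\mathcal{V}$, then $\mathrm{Ker}\{\mathbb{A}[\mathbf{u}_0](\mathbf{x})\}=\{\mathbf{0}\}$ for almost every $\mathbf{x}\in\Omega$.
   Context: Let $d\in\{2,3\}$ and let $\Omega\subset\mathbb{R}^d$ be a bounded domain (connected open set). Fix $\epsilon>0$ and let $H_\epsilon(\mathbf{x})$ be the ball of radius $\epsilon$ centered at $\mathbf{x}$; $\omega_d$ is the volume of the unit ball of $\mathbb{R}^d$; $\mathbf{e}_{\mathbf{y}-\mathbf{x}}=(\mathbf{y}-\mathbf{x})/|\mathbf{y}-\mathbf{x}|$. $J$ is a non-negative bounded measurable function supported on $[0,1]$ and $J^\epsilon(r)=J(r/\epsilon)$. The function $g:\mathbb{R}\to\mathbb{R}$ is three times continuously differentiable, $g,g',g'',g'''$ are bounded, $g(0)=0$, $g(r)>0$ for $r\ne0$, $g$ is convex on $(r^e,r^c)$ with $r^e<0<r^c$ and concave outside this interval, has finite limits at $\pm\infty$, and $\max_r|g''(r)|=g''(0)$. The strain is $S(\mathbf{y},\mathbf{x},\mathbf{u})=\frac{\mathbf{u}(\mathbf{y})-\mathbf{u}(\mathbf{x})}{|\mathbf{y}-\mathbf{x}|}\cdot\mathbf{e}_{\mathbf{y}-\mathbf{x}}$. Let $\Pi=\{\mathbf{Q}\mathbf{x}+\mathbf{c}:\mathbf{Q}^T=-\mathbf{Q}\in\mathbb{R}^{d\times d},\ \mathbf{c}\in\mathbb{R}^d\}$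 and $\mathcal{V}=\{\mathbf{u}\in L^\infty(\Omega;\mathbb{R}^d):\int_\Omega\mathbf{u}\cdot\mathbf{w}\,d\mathbf{x}=0\ \text{for all }\mathbf{w}\in\Pi\}$ with the norm $\|\cdot\|_\infty$. For $\mathbf{u}\in\mathcal{V}$ the bounded linear operator $D(\mathcal{L})[\mathbf{u}]:\mathcal{V}\to\mathcal{V}$ is $$D(\mathcal{L})[\mathbf{u}]\mathbf{w}(\mathbf{x})=-\int_{H_\epsilon(\mathbf{x})\cap\Omega}\frac{J^\epsilon(|\mathbf{y}-\mathbf{x}|)}{\epsilon^{d+1}\omega_d}\,g''\!\left(\sqrt{|\mathbf{y}-\mathbf{x}|}\,S(\mathbf{y},\mathbf{x},\mathbf{u})\right)S(\mathbf{y},\mathbf{x},\mathbf{w})\,\mathbf{e}_{\mathbf{y}-\mathbf{x}}\,d\mathbf{y},$$ and the stability tensor is $$\mathbb{A}[\mathbf{u}](\mathbf{x})=\int_{H_\epsilon(\mathbf{x})\cap\Omega}\frac{J^\epsilon(|\mathbf{y}-\mathbf{x}|)}{\epsilon^{d+1}\omega_d|\mathbf{y}-\mathbf{x}|}\,g''\!\left(\sqrt{|\mathbf{y}-\mathbf{x}|}\,S(\mathbf{y},\mathbf{x},\mathbf{u})\right)\mathbf{e}_{\mathbf{y}-\mathbf{x}}\otimes\mathbf{e}_{\mathbf{y}-\mathbf{x}}\,d\mathbf{y}.$$ *)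

(* Defs.v *)
From HB Require Import structures.
From mathcomp Require Import all_boot all_order all_algebra.
From mathcomp Require Import all_classical all_reals all_analysis.
From mathcomp Require Import ess_sup_inf.

Set Implicit Arguments.
Unset Strict Implicit.
Unset Printing Implicit Defensive.
Import Order.TTheory GRing.Theory Num.Theory.
Import numFieldNormedType.Exports.

Local Open Scope classical_set_scope.
Local Open Scope ring_scope.

(* R^d is 'cV[R]_d, so that matrices act on the left. *)

(* 'cV[R]_n carries the sigma-algebra generated by the coordinates; it contains
   the open sets (open_measurable_cV), hence is the Borel sigma-algebra.      *)
Definition measure_cV_display : measure_display.
Proof. exact. Qed.

Section measurable_cV.
Context {R : realType} (n : nat).

Let coors : 'I_n -> 'cV[R]_n -> R := fun i x => x i 0.

Let cV_set0 : g_sigma_preimage coors set0.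
Proof. exact: sigma_algebra0. Qed.

Let cV_setC A : g_sigma_preimage coors A -> g_sigma_preimage coors (~` A).
Proof. exact: sigma_algebraC. Qed.

Let cV_bigcup (F : _^nat) : (forall i, g_sigma_preimage coors (F i)) ->
  g_sigma_preimage coors (\bigcup_i (F i)).
Proof. exact: sigma_algebra_bigcup. Qed.

HB.instance Definition _ := @isMeasurable.Build measure_cV_display
  'cV[R]_n (g_sigma_preimage coors) cV_set0 cV_setC cV_bigcup.

Lemma measurable_coor (i : 'I_n) :
  measurable_fun [set: 'cV[R]_n] (fun x : 'cV[R]_n => x i 0).
Proof.
move=> _ Y mY; rewrite setTI; apply: sub_sigma_algebra => /=.
rewrite -bigcup_seq/=; exists i => /=; first by rewrite mem_index_enum.
by exists Y => //; rewrite setTI.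
Qed.

Lemma measurable_fun_coorP d (T : measurableType d) (f : T -> 'cV[R]_n) :
  measurable_fun [set: T] f <->
  forall i, measurable_fun [set: T] (fun x => f x i 0).
Proof.
split=> [mf i|mf]; first exact: measurableT_comp (measurable_coor i) mf.
move=> _ A mA; rewrite setTI.
suff : g_sigma_preimage coors `<=` [set B | measurable (f @^-1` B)] by apply.
apply: smallest_sub.
  split => /=.
  - by rewrite preimage_set0.
  - by move=> B mB; rewrite setTD preimage_setC; exact: measurableC.
  - by move=> F mF; rewrite preimage_bigcup; exact: bigcupT_measurable.
rewrite -bigcup_seq => B [i _ [C mC <-]]; rewrite /= setTI.
by rewrite -[X in measurable X]setTI; exact: (mf i).
Qed.

End measurable_cV.

Section cV_cons.
Context {R : realType}.

Definition cV_cons n (p : measurableTypeR R * 'cV[R]_n) : 'cV[R]_n.+1 :=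
  col_mx p.1%:M p.2.

Lemma cV_cons0 n p : @cV_cons n p ord0 0 = p.1.
Proof.
transitivity (@cV_cons n p (lshift n (ord0 : 'I_1)) 0).
  by congr (cV_cons p _ 0); exact: val_inj.
by rewrite /cV_cons (@col_mxEu _ 1) mxE.
Qed.

Lemma cV_consS n p i : @cV_cons n p (lift ord0 i) 0 = p.2 i 0.
Proof.
transitivity (@cV_cons n p (rshift 1 i) 0).
  by congr (cV_cons p _ 0); exact: val_inj.
by rewrite /cV_cons (@col_mxEd _ 1).
Qed.

Lemma measurable_cV_cons n : measurable_fun setT (@cV_cons n).
Proof.
apply/measurable_fun_coorP => i; case: (unliftP ord0 i) => [j|] ->.
  under eq_fun do rewrite cV_consS.
  exact: measurableT_comp (measurable_coor j) measurable_snd.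
under eq_fun do rewrite cV_cons0.
exact: measurable_fst.
Qed.

Definition cV_uncons n (x : 'cV[R]_n.+1) : measurableTypeR R * 'cV[R]_n :=
  (x ord0 0, \col_i x (lift ord0 i) 0).

Lemma cV_consK n : cancel (@cV_cons n) (@cV_uncons n).
Proof.
move=> [a v]; rewrite /cV_uncons cV_cons0; congr pair.
by apply/colP => i; rewrite mxE cV_consS.
Qed.

Lemma cV_unconsK n : cancel (@cV_uncons n) (@cV_cons n).
Proof.
move=> x; apply/colP => i; case: (unliftP ord0 i) => [j|] ->.
  by rewrite cV_consS mxE.
by rewrite cV_cons0.
Qed.

Lemma measurable_cV_uncons n : measurable_fun setT (@cV_uncons n).
Proof.
apply: measurable_fun_pair; first exact: measurable_coor.
apply/measurable_fun_coorP => i; under eq_fun do rewrite mxE.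
exact: measurable_coor.
Qed.

End cV_cons.

Section lebesgue_cVS.
Local Open Scope ereal_scope.
Context {R : realType} (n : nat).
Variable mu : {sigma_finite_measure set 'cV[R]_n -> \bar R}.

Definition lebesgue_cVS : set 'cV[R]_n.+1 -> \bar R :=
  pushforward (lebesgue_measure \x mu) (@cV_cons R n).

Let preimage_cons A : measurable A -> measurable (@cV_cons R n @^-1` A).
Proof.
by move=> mA; rewrite -[X in measurable X]setTI; exact: measurable_cV_cons.
Qed.

Let lebesgue_cVS0 : lebesgue_cVS set0 = 0.
Proof. by rewrite /lebesgue_cVS /pushforward preimage_set0 measure0. Qed.

Let lebesgue_cVS_ge0 A : 0 <= lebesgue_cVS A.
Proof. by rewrite /lebesgue_cVS /pushforward measure_ge0. Qed.

Let lebesgue_cVS_sigma_additive : semi_sigma_additive lebesgue_cVS.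
Proof.
move=> F mF tF mUF; rewrite /lebesgue_cVS /pushforward preimage_bigcup.
apply: measure_semi_sigma_additive.
- by move=> i; exact: preimage_cons.
- apply/trivIsetP => /= i j _ _ ij; rewrite -preimage_setI.
  by move/trivIsetP : tF => /(_ _ _ _ _ ij) ->//; rewrite preimage_set0.
- by rewrite -preimage_bigcup; exact: preimage_cons.
Qed.

HB.instance Definition _ := isMeasure.Build _ _ _ lebesgue_cVS
  lebesgue_cVS0 lebesgue_cVS_ge0 lebesgue_cVS_sigma_additive.

Lemma lebesgue_cVSE (A : set R) (B : set 'cV[R]_n) :
  measurable A -> measurable B ->
  lebesgue_cVS (@cV_uncons R n @^-1` (A `*` B)) = lebesgue_measure A * mu B.
Proof.
move=> mA mB; rewrite -product_measure1E//; rewrite /lebesgue_cVS /pushforward -comp_preimage.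
by rewrite (_ : _ \o _ = id)//; apply/funext => p; exact: cV_consK.
Qed.

Let lebesgue_cVS_sigma_finite : sigma_finite setT lebesgue_cVS.
Proof.
have /sigma_finiteP[F [TF ndF Foo]] := sigma_finiteT (@lebesgue_measure R).
have /sigma_finiteP[G [TG ndG Goo]] := sigma_finiteT mu.
exists (fun k => @cV_uncons R n @^-1` (F k `*` G k)).
  rewrite -preimage_bigcup (_ : \bigcup_i _ = setT) ?preimage_setT//.
  rewrite -subTset -setXTT TF TG => -[x y] [/= [k _ Fkx] [l _ Gly]].
  exists (maxn k l) => //; split.
    by move: x Fkx; exact/subsetPset/ndF/leq_maxl.
  by move: y Gly; exact/subsetPset/ndG/leq_maxr.
move=> k; have [mF Fk] := Foo k; have [mG Gk] := Goo k; split.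
  by rewrite -[X in measurable X]setTI; apply: measurable_cV_uncons => //;
    exact: measurableX.
by rewrite lebesgue_cVSE// lte_mul_pinfty// ge0_fin_numE.
Qed.

HB.instance Definition _ := Measure_isSigmaFinite.Build _ _ _ lebesgue_cVS
  lebesgue_cVS_sigma_finite.

End lebesgue_cVS.

(* Lebesgue measure on R^n as an iterated product of the one-dimensional one;
   lebesgue_cV_box gives its value on boxes.                                  *)
Fixpoint lebesgue_cV (R : realType) (n : nat) :
    {sigma_finite_measure set 'cV[R]_n -> \bar R} :=
  match n with
  | 0 => \d_(0 : 'cV[R]_0)
  | n'.+1 => lebesgue_cVS (lebesgue_cV R n')
  end.

Section lebesgue_cV_theory.
Context {R : realType}.

Definition cV_box n (a b : 'cV[R]_n) : set 'cV[R]_n :=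
  [set x : 'cV[R]_n | forall i, a i 0 <= x i 0 <= b i 0].

Lemma measurable_cV_box n (a b : 'cV[R]_n) : measurable (cV_box a b).
Proof.
rewrite (_ : cV_box a b = \big[setI/setT]_(i < n)
    [set x : 'cV[R]_n | `[a i 0, b i 0]%classic (x i 0)]).
  apply: bigsetI_measurable => i _; rewrite -[X in measurable X]setTI.
  by apply: measurable_coor => //; exact: measurable_itv.
apply/seteqP; split=> x /=.
  by move=> abx; rewrite -bigcap_seq => i _ /=; rewrite in_itv/=; exact: abx.
rewrite -bigcap_seq => + i => /(_ i); rewrite /= in_itv/=; apply.
by rewrite mem_index_enum.
Qed.

Lemma lebesgue_cV_box n (a b : 'cV[R]_n) : (forall i, a i 0 <= b i 0) ->
  lebesgue_cV R n (cV_box a b) = (\prod_i (b i 0 - a i 0))%:E.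
Proof.
elim: n a b => [|n IH] a b ab.
  rewrite big_ord0 /= diracE mem_set//= => -[]//.
pose a' := \col_i a (lift ord0 i) 0; pose b' := \col_i b (lift ord0 i) 0.
have -> : cV_box a b = @cV_uncons R n @^-1`
    (`[a ord0 0, b ord0 0]%classic `*` cV_box a' b').
  apply/seteqP; split=> x /=.
    move=> abx; split; first by rewrite in_itv/=.
    by move=> i; rewrite !mxE.
  move=> [+ abx] i; rewrite in_itv/= => x0.
  case: (unliftP ord0 i) => [j|] ->//.
  by have := abx j; rewrite !mxE.
rewrite [LHS]lebesgue_cVSE; [|exact: measurable_itv|exact: measurable_cV_box].
rewrite IH; last by move=> i; rewrite !mxE.
rewrite lebesgue_measure_itv/= lte_fin big_ord_recl.
under eq_bigr do rewrite !mxE.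
have := ab ord0; rewrite le_eqVlt => /orP[/eqP ->|ab0].
  by rewrite ltxx mul0e subrr mul0r.
by rewrite ab0.
Qed.

Lemma open_measurable_cV n (U : set 'cV[R]_n) : open U -> measurable U.
Proof.
move=> oU.
pose box (ab : 'cV[rat]_n * 'cV[rat]_n) :=
  cV_box (map_mx (@ratr R) ab.1) (map_mx (@ratr R) ab.2).
pose F k : set 'cV[R]_n := if unpickle k is Some ab then
  if `[< box ab `<=` U >] then box ab else set0 else set0.
rewrite (_ : U = \bigcup_k F k).
  apply: bigcupT_measurable => k; rewrite /F; case: unpickle => // ab.
  by case: ifP => // _; exact: measurable_cV_box.
apply/seteqP; split=> x; last first.
  move=> [k _]; rewrite /F; case: unpickle => // ab.
  by case: ifPn => // /asboolP; apply.
move=> Ux; have /nbhs_ballP[e /= e0 xeU] := open_nbhs_nbhs (conj oU Ux).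
have ex i : exists ab : rat * rat,
    x i 0 - e < ratr ab.1 < x i 0 /\ x i 0 < ratr ab.2 < x i 0 + e.
  have /rat_in_itvoo[q xq] : x i 0 - e < x i 0 by rewrite ltrBlDr ltrDl.
  have /rat_in_itvoo[r xr] : x i 0 < x i 0 + e by rewrite ltrDl.
  by exists (q, r); rewrite !inE/= in xq, xr.
have [f Hf] := choice ex.
exists (pickle (\col_i (f i).1, \col_i (f i).2)) => //.
rewrite /F pickleK ifT.
  move=> i; rewrite !mxE.
  by have [/andP[_ /ltW ->] /andP[/ltW -> _]] := Hf i.
apply/asboolP => y abxy; apply: xeU; split => // i j.
have := abxy i; rewrite ord1 !mxE => /andP[fy yf].
have [/andP[xf _] /andP[_ fx]] := Hf i.
by rewrite /ball/= ltr_distlC (lt_le_trans xf fy) (le_lt_trans yf fx).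
Qed.

End lebesgue_cV_theory.

Section peridynamics.
Context {R : realType} (d : nat).
Implicit Types (x y e : 'cV[R]_d) (u w : 'cV[R]_d -> 'cV[R]_d).
Implicit Types (Omega : set 'cV[R]_d).

Local Notation mu := (lebesgue_cV R d).

Definition dotp x y : R := \sum_i x i 0 * y i 0.

(* The library norm on matrices is the sup norm. *)
Definition enorm x : R := Num.sqrt (dotp x x).

Definition eball x (r : R) : set 'cV[R]_d := [set y | enorm (y - x) < r].

Definition unit_ball_volume : R := fine (mu (eball 0 1)).

(* At y = x the junk value is 0; {x} is Lebesgue negligible for d > 0. *)
Definition direction y x : 'cV[R]_d := (enorm (y - x))^-1 *: (y - x).

Definition strain y x u : R :=
  dotp ((enorm (y - x))^-1 *: (u y - u x)) (direction y x).

Definition rigid_motion : set ('cV[R]_d -> 'cV[R]_d) :=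
  [set w | exists (Q : 'M[R]_d) (c : 'cV[R]_d),
     Q^T = - Q /\ w = (fun x => Q *m x + c)].

(* The functions are total, but only their values on Omega matter, up to
   almost everywhere equality on Omega.                                       *)
Definition Linfty_norm Omega u : \bar R :=
  ess_sup mu (fun x => (((enorm \o u) \_ Omega) x)%:E).

Definition Linfty Omega : set ('cV[R]_d -> 'cV[R]_d) :=
  [set u | measurable_fun Omega u /\ (Linfty_norm Omega u < +oo)%E].

Definition Vspace Omega : set ('cV[R]_d -> 'cV[R]_d) :=
  [set u | Linfty Omega u /\
     forall w, rigid_motion w -> \int[mu]_(x in Omega) dotp (u x) (w x) = 0].

Section operators.
Variables (Omega : set 'cV[R]_d) (J g : R -> R) (eps : R).

(* The factor common to the integrands of linearized_op and stability_tensor. *)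
Definition kernel_weight y x u : R :=
  J (enorm (y - x) / eps) / (eps ^+ d.+1 * unit_ball_volume) *
  g^`(2)%classic (Num.sqrt (enorm (y - x)) * strain y x u).

Definition linearized_op u w x : 'cV[R]_d :=
  - \col_i \int[mu]_(y in eball x eps `&` Omega)
      (kernel_weight y x u * strain y x w * direction y x i 0).

Definition stability_tensor u x : 'M[R]_d :=
  \matrix_(i, j) \int[mu]_(y in eball x eps `&` Omega)
    (kernel_weight y x u / enorm (y - x) *
     (direction y x *m (direction y x)^T) i j).

End operators.

(* T has a two-sided inverse on V, a space of classes modulo almost everywhere
   equality on Omega. Boundedness of the inverse is not required.             *)
Definition has_inverse_on_V Omega
    (T : ('cV[R]_d -> 'cV[R]_d) -> ('cV[R]_d -> 'cV[R]_d)) : Prop :=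
  exists S : ('cV[R]_d -> 'cV[R]_d) -> ('cV[R]_d -> 'cV[R]_d),
    [/\ forall v, Vspace Omega v -> Vspace Omega (S v),
        forall v w, Vspace Omega v -> Vspace Omega w ->
          v = w %[ae mu in Omega] -> S v = S w %[ae mu in Omega],
        forall w, Vspace Omega w -> S (T w) = w %[ae mu in Omega] &
        forall v, Vspace Omega v -> T (S v) = v %[ae mu in Omega]].

End peridynamics.

(* Main.v *)
Require Import Defs.
From HB Require Import structures.
From mathcomp Require Import all_boot all_order all_algebra.
From mathcomp Require Import all_classical all_reals all_analysis.
From mathcomp Require Import measurable_realfun ess_sup_inf ring lra.

Set Implicit Arguments.
Unset Strict Implicit.
Unset Printing Implicit Defensive.
Import Order.TTheory GRing.Theory Num.Theory.
Import numFieldNormedType.Exports.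

Local Open Scope classical_set_scope.
Local Open Scope ring_scope.

(** Write T for the linearized operator at u0, A x for the stability tensor and
    a x y for the symmetric scalar kernel, which is at most C / |y - x|. If A is
    singular on a set of positive measure, there is an unbounded field W for
    which T W is nevertheless bounded, and this contradicts invertibility.

    Splitting the difference W y - W x in the integral defining T gives
      T W x = A x W x - (average of W against a)
    (singular_opE). In dimension at least 2 the kernel is integrable to some
    power above 1, so the average of a field with enough integrability is
    bounded (averaging_coord_bounded). The quantitative form of this is the
    pointwise inequality
      t / |y - x| <= 2 m (x, y) + 2 t ^ 3 + 1,
    where the dyadic majorant m has integrals in y bounded uniformly in x
    (inverse_distance_majorant, integral_majorant): it separates the singularity
    from the field. It remains to find W unbounded, in L6, with A W bounded. On
    disjoint subsets of the degenerate set whose measures decrease like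
    128 ^ -n, let W be 2 ^ n times a constant rational vector q that A almost
    annihilates; rational vectors being countable, a single q serves on a set of
    positive measure (exists_unbounded_field).

    The operator T is symmetric for the L2 pairing, by Fubini (singular_op_sym),
    and kills rigid motions (singular_op_rigid). So T W is orthogonal to rigid
    motions and lies in Vspace (Vspace_image); let v in Vspace be its preimage
    under T, and h = v - W, so that T h = 0. Every psi in Vspace is T phi for
    some phi in Vspace, whence the pairing of h with psi is that of T h with phi,
    namely 0 (kernel_annihilates_Vspace). As Vspace is cut out of the bounded
    fields by finitely many conditions, a field orthogonal to it is affine on
    Omega, so bounded (Vspace_annihilator_bounded, a consequence of the linear
    algebra lemma functional_span). Then W = v - h is bounded, a contradiction
    (degenerate_null). *)

(** * Coordinates, Euclidean norm and directions *)

Section vectors.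
Context {R : realType} {d : nat}.
Implicit Types (x y a e : 'cV[R]_d).

Definition norm1 x : R := \sum_i `|x i 0|.

Lemma norm1_ge0 x : 0 <= norm1 x.
Proof. exact: sumr_ge0. Qed.

Lemma norm1_0 : norm1 0 = 0.
Proof. by rewrite /norm1 big1// => i _; rewrite mxE normr0. Qed.

Lemma norm1D x y : norm1 (x + y) <= norm1 x + norm1 y.
Proof.
by rewrite /norm1 -big_split/=; apply: ler_sum => i _; rewrite mxE ler_normD.
Qed.

Lemma norm1N x : norm1 (- x) = norm1 x.
Proof. by apply: eq_bigr => i _; rewrite mxE normrN. Qed.

Lemma norm1B x y : norm1 (x - y) <= norm1 x + norm1 y.
Proof. by rewrite (le_trans (norm1D _ _))// norm1N. Qed.

Lemma norm1Z (k : R) x : norm1 (k *: x) = `|k| * norm1 x.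
Proof. by rewrite mulr_sumr; apply: eq_bigr => i _; rewrite mxE normrM. Qed.

Lemma coord_le_norm1 x i : `|x i 0| <= norm1 x.
Proof. by rewrite /norm1 (bigD1 i)//= lerDl sumr_ge0. Qed.

Lemma dotp_ge0 x : 0 <= dotp x x.
Proof. by apply: sumr_ge0 => i _; rewrite -expr2 sqr_ge0. Qed.

Lemma enorm_ge0 x : 0 <= enorm x.
Proof. exact: sqrtr_ge0. Qed.

Lemma enormN x : enorm (- x) = enorm x.
Proof.
by congr Num.sqrt; apply: eq_bigr => i _; rewrite !mxE mulrNN.
Qed.

Lemma enormB x y : enorm (x - y) = enorm (y - x).
Proof. by rewrite -enormN opprB. Qed.

Lemma enorm0 : enorm (0 : 'cV[R]_d) = 0.
Proof. by rewrite /enorm /dotp big1 ?sqrtr0// => i _; rewrite mxE mul0r. Qed.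

Lemma coord_le_enorm x i : `|x i 0| <= enorm x.
Proof.
rewrite -sqrtr_sqr ler_wsqrtr// expr2 /dotp (bigD1 i)//= lerDl.
by apply: sumr_ge0 => j _; rewrite -expr2 sqr_ge0.
Qed.

Lemma enorm_le_norm1 x : enorm x <= norm1 x.
Proof.
rewrite -(ler_pXn2r (ltn0Sn 1)) ?nnegrE ?enorm_ge0 ?norm1_ge0//.
rewrite sqr_sqrtr ?dotp_ge0// expr2 mulr_suml; apply: ler_sum => i _.
rewrite (le_trans (ler_norm _))// normrM ler_wpM2l//.
exact: coord_le_norm1.
Qed.

Lemma norm1_le_enorm x : norm1 x <= d%:R * enorm x.
Proof.
rewrite -[d in d%:R]card_ord -sum1_card natr_sum mulr_suml.
by apply: ler_sum => i _; rewrite mul1r coord_le_enorm.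
Qed.

Lemma enorm_eq0 x : (enorm x == 0) = (x == 0).
Proof.
apply/eqP/eqP => [x0|->]; last exact: enorm0.
apply/colP => i; rewrite mxE; apply/eqP; rewrite -normr_le0.
by rewrite -x0 coord_le_enorm.
Qed.

Lemma direction_le1 y x i : `|direction y x i 0| <= 1.
Proof.
rewrite /direction mxE normrM normfV (ger0_norm (enorm_ge0 _))//.
have [->|yx0] := eqVneq (enorm (y - x)) 0; first by rewrite invr0 mul0r ler01.
rewrite mulrC ler_pdivrMr ?mul1r ?coord_le_enorm//.
by rewrite lt_neqAle eq_sym yx0 enorm_ge0.
Qed.

Lemma directionC y x : direction y x = - direction x y.
Proof. by rewrite /direction enormB -scalerN opprB. Qed.

Lemma dotpNr a e : dotp a (- e) = - dotp a e.
Proof. by rewrite -sumrN; apply: eq_bigr => i _; rewrite mxE mulrN. Qed.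

Lemma dotpC a e : dotp a e = dotp e a.
Proof. by apply: eq_bigr => i _; rewrite mulrC. Qed.

Lemma dotpNl a e : dotp (- a) e = - dotp a e.
Proof. by rewrite dotpC dotpNr dotpC. Qed.

Lemma dotpDl x y e : dotp (x + y) e = dotp x e + dotp y e.
Proof.
by rewrite -big_split/=; apply: eq_bigr => i _; rewrite mxE mulrDl.
Qed.

Lemma dotpBl x y e : dotp (x - y) e = dotp x e - dotp y e.
Proof. by rewrite dotpDl dotpNl. Qed.

Lemma dotpZl (k : R) x e : dotp (k *: x) e = k * dotp x e.
Proof. by rewrite mulr_sumr; apply: eq_bigr => i _; rewrite mxE mulrA. Qed.

Lemma dotp0l e : dotp 0 e = 0.
Proof. by rewrite /dotp big1// => i _; rewrite mxE mul0r. Qed.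

Lemma dotp_le a e c : (forall i, `|e i 0| <= c) -> `|dotp a e| <= norm1 a * c.
Proof.
move=> e1; rewrite (le_trans (ler_norm_sum _ _ _))// mulr_suml.
by apply: ler_sum => i _; rewrite normrM ler_wpM2l.
Qed.

Lemma dotp_direction_le a y x : `|dotp a (direction y x)| <= norm1 a.
Proof. by rewrite -[leRHS]mulr1; apply: dotp_le => i; exact: direction_le1. Qed.

Lemma strainE y x (w : 'cV[R]_d -> 'cV[R]_d) :
  strain y x w = (enorm (y - x))^-1 * dotp (w y - w x) (direction y x).
Proof. by rewrite /strain dotpZl. Qed.

Lemma strainC y x (w : 'cV[R]_d -> 'cV[R]_d) : strain y x w = strain x y w.
Proof.
by rewrite !strainE enormB directionC dotpNr -dotpNl opprB.
Qed.

End vectors.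

Section measurability.
Context {R : realType} {n : nat} {disp : measure_display}
  {T : measurableType disp}.
Implicit Types f g : T -> 'cV[R]_n.

Lemma measurable_coord f i : measurable_fun [set: T] f ->
  measurable_fun [set: T] (fun t => f t i 0).
Proof. by move/measurable_fun_coorP. Qed.

Lemma measurable_cVB f g : measurable_fun [set: T] f ->
  measurable_fun [set: T] g -> measurable_fun [set: T] (fun t => f t - g t).
Proof.
move=> mf mg; apply/measurable_fun_coorP => i.
under eq_fun do rewrite !mxE.
by apply: measurable_funB; exact: measurable_coord.
Qed.

Lemma measurable_cVZ (k : T -> R) f : measurable_fun [set: T] k ->
  measurable_fun [set: T] f -> measurable_fun [set: T] (fun t => k t *: f t).
Proof.
move=> mk mf; apply/measurable_fun_coorP => i.
under eq_fun do rewrite !mxE.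
by apply: measurable_funM => //; exact: measurable_coord.
Qed.

Lemma measurable_dotp f g : measurable_fun [set: T] f ->
  measurable_fun [set: T] g -> measurable_fun [set: T] (fun t => dotp (f t) (g t)).
Proof.
move=> mf mg; apply: measurable_sum => i.
by apply: measurable_funM; exact: measurable_coord.
Qed.

Lemma measurable_norm1 f : measurable_fun [set: T] f ->
  measurable_fun [set: T] (fun t => norm1 (f t)).
Proof.
move=> mf; apply: measurable_sum => i.
by apply: measurableT_comp => //; exact: measurable_coord.
Qed.

Lemma measurable_enorm f : measurable_fun [set: T] f ->
  measurable_fun [set: T] (fun t => enorm (f t)).
Proof.
move=> mf; under eq_fun do rewrite /enorm -powR12_sqrt ?dotp_ge0//.
apply: (measurableT_comp (f := @powR R ^~ _)); first exact: measurable_powR.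
exact: measurable_dotp.
Qed.

(** On nonnegative numbers the inverse is the power -1, also at 0. *)
Lemma measurable_inv_enorm f : measurable_fun [set: T] f ->
  measurable_fun [set: T] (fun t => (enorm (f t))^-1).
Proof.
move=> mf; under eq_fun do rewrite -powR_inv1 ?enorm_ge0//.
apply: (measurableT_comp (f := @powR R ^~ _)); first exact: measurable_powR.
exact: measurable_enorm.
Qed.

Lemma measurable_direction f g : measurable_fun [set: T] f ->
  measurable_fun [set: T] g -> measurable_fun [set: T] (fun t => direction (f t) (g t)).
Proof.
move=> mf mg; apply: measurable_cVZ; last exact: measurable_cVB.
by apply: measurable_inv_enorm; exact: measurable_cVB.
Qed.

End measurability.
(** * Fields with an integrable sixth power *)

Section sixth_power.
Context {R : realType}.
Implicit Types s t : R.

Lemma cube_le_sixth s : 0 <= s -> s ^+ 3 <= s ^+ 6 + 1.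
Proof.
move=> s0; have -> : s ^+ 6 = (s ^+ 3) ^+ 2 by rewrite -exprM.
by have := sqr_ge0 (s ^+ 3 - 1); have := exprn_ge0 3 s0; nra.
Qed.

Lemma mul_cube_le_sixth s t : (s * t) ^+ 3 <= s ^+ 6 + t ^+ 6.
Proof.
have -> : s ^+ 6 = (s ^+ 3) ^+ 2 by rewrite -exprM.
have -> : t ^+ 6 = (t ^+ 3) ^+ 2 by rewrite -exprM.
by rewrite exprMn; have := sqr_ge0 (s ^+ 3 - t ^+ 3);
  have := sqr_ge0 (s ^+ 3 + t ^+ 3); nra.
Qed.

End sixth_power.

Section L6.
Context {R : realType} {d : nat}.
Local Notation V := 'cV[R]_d.
Local Notation mu := (lebesgue_cV R d).
Implicit Types f h : V -> V.

(** The exponent 6 is what Young's inequality asks for: the product of two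
    fields of L6 has an integrable cube. *)
Definition L6 f := measurable_fun [set: V] f /\
  (\int[mu]_x (norm1 (f x) ^+ 6)%:E < +oo)%E.

Lemma measurable_norm1_6 f : measurable_fun [set: V] f ->
  measurable_fun [set: V] (fun x => norm1 (f x) ^+ 6).
Proof. by move=> mf; apply: measurable_funX; exact: measurable_norm1. Qed.

Lemma L6B f h : L6 f -> L6 h -> L6 (fun x => f x - h x).
Proof.
move=> [mf foo] [mh hoo]; split; first exact: measurable_cVB.
apply: (@le_lt_trans _ _
    (\int[mu]_x (64%:E * (norm1 (f x) ^+ 6)%:E + 64%:E * (norm1 (h x) ^+ 6)%:E))%E).
  apply: ge0_le_integral => //.
  - by move=> x _; rewrite lee_fin exprn_ge0 ?norm1_ge0.
  - by apply/measurable_EFinP; apply: measurable_norm1_6; exact: measurable_cVB.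
  - by apply: emeasurable_funD; apply: emeasurable_funM => //;
      apply/measurable_EFinP; apply: measurable_norm1_6.
  - move=> x _; rewrite -!EFinM -EFinD lee_fin -mulrDr.
    have [f0 h0] := (norm1_ge0 (f x), norm1_ge0 (h x)).
    rewrite (@le_trans _ _ ((norm1 (f x) + norm1 (h x)) ^+ 6))//.
      by rewrite lerXn2r ?nnegrE ?addr_ge0 ?norm1_ge0 ?norm1B.
    move: (norm1 (f x)) (norm1 (h x)) f0 h0 => s t s0 t0.
    wlog st : s t s0 t0 / s <= t.
      move=> hwlog; have [/hwlog|/ltW/hwlog] := leP s t; first exact.
      by rewrite addrC (addrC (s ^+ 6)); exact.
    apply: (@le_trans _ _ ((2 * t) ^+ 6)).
      by rewrite lerXn2r ?nnegrE ?addr_ge0 ?mulr_ge0//; lra.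
    have -> : (2 * t) ^+ 6 = 64 * t ^+ 6 by ring.
    by rewrite ler_pM2l// lerDr exprn_ge0.
rewrite ge0_integralD//; last 4 first.
- by move=> x _; rewrite mule_ge0// lee_fin exprn_ge0 ?norm1_ge0.
- by apply: emeasurable_funM => //; apply/measurable_EFinP; apply: measurable_norm1_6.
- by move=> x _; rewrite mule_ge0// lee_fin exprn_ge0 ?norm1_ge0.
- by apply: emeasurable_funM => //; apply/measurable_EFinP; apply: measurable_norm1_6.
rewrite !ge0_integralZl_EFin//; last 4 first.
- by move=> x _; rewrite lee_fin exprn_ge0 ?norm1_ge0.
- by apply/measurable_EFinP; apply: measurable_norm1_6.
- by move=> x _; rewrite lee_fin exprn_ge0 ?norm1_ge0.
- by apply/measurable_EFinP; apply: measurable_norm1_6.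
by rewrite lte_add_pinfty// lte_mul_pinfty.
Qed.

End L6.

(** * A dyadic majorant of the singularity *)

Lemma nneseries_le (R : realType) (f : nat -> \bar R) (M : \bar R) :
  (forall k, 0 <= f k)%E -> (forall n, \sum_(0 <= k < n) f k <= M)%E ->
  (\sum_(0 <= k <oo) f k <= M)%E.
Proof.
move=> f0 fM; apply: lime_le; first by apply: is_cvg_nneseries.
exact: nearW.
Qed.

Lemma nneseries_ge (R : realType) (f : nat -> \bar R) (k : nat) :
  (forall k, 0 <= f k)%E -> (f k <= \sum_(0 <= k <oo) f k)%E.
Proof.
move=> f0; rewrite (le_trans _ (nneseries_lim_ge k.+1 _))//.
by rewrite big_nat_recr//= leeDr// sume_ge0.
Qed.

Lemma dyadic_scale (R : realType) (r : R) : 0 < r -> r <= 1 ->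
  exists k : nat, 2^-1 ^+ k.+1 < r <= 2^-1 ^+ k.
Proof.
move=> r0 r1.
have ex : exists k : nat, (2^-1 : R) ^+ k.+1 < r.
  exists (Num.truncn r^-1); rewrite exprVn invf_plt ?posrE ?exprn_gt0//.
  apply: (lt_le_trans (truncnS_gt _)).
  by rewrite -natrX ler_nat ltnW// ltn_expl.
case: (ex_minnP ex) => k kr kmin; exists k; rewrite kr /=.
case: k kr kmin => [|k] kr kmin; first by rewrite expr0.
by rewrite leNgt; apply/negP => /kmin; rewrite ltnn.
Qed.

Section dyadic_majorant.
Context {R : realType} (d : nat).
Implicit Types x y : 'cV[R]_d.
Local Notation mu := (lebesgue_cV R d).

Definition cube_nbhs k : set ('cV[R]_d * 'cV[R]_d) :=
  [set z : 'cV[R]_d * 'cV[R]_d | forall i : 'I_d, `|z.2 i 0 - z.1 i 0| <= 2^-1 ^+ k].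

(** Roughly the distance to the power - log2 3: the exponent log2 3 lies
    strictly between 1, the order of the singularity, and the dimension. *)
Definition majorant (z : 'cV[R]_d * 'cV[R]_d) : \bar R :=
  (\sum_(0 <= k <oo) (3 ^+ k * \1_(cube_nbhs k) z)%:E)%E.

Lemma majorant_term_ge0 k z : (0 <= (3 ^+ k * \1_(cube_nbhs k) z : R)%:E)%E.
Proof. by rewrite lee_fin mulr_ge0// exprn_ge0. Qed.

Lemma majorant_ge0 z : (0 <= majorant z)%E.
Proof. by apply: nneseries_ge0 => k _ _; exact: majorant_term_ge0. Qed.

Lemma measurable_cube_nbhs k : measurable (cube_nbhs k).
Proof.
rewrite (_ : cube_nbhs k = \big[setI/setT]_(i < d)
    ((fun z : 'cV[R]_d * 'cV[R]_d => `|z.2 i 0 - z.1 i 0|) @^-1`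
      `]-oo, 2^-1 ^+ k]%classic)).
  apply: bigsetI_measurable => i _; rewrite -[X in measurable X]setTI.
  have m : measurable_fun [set: 'cV[R]_d * 'cV[R]_d]
      (fun z : 'cV[R]_d * 'cV[R]_d => `|z.2 i 0 - z.1 i 0|).
    apply: measurableT_comp => //; apply: measurable_funB.
      exact: measurableT_comp (measurable_coor i) measurable_snd.
    exact: measurableT_comp (measurable_coor i) measurable_fst.
  exact: m.
apply/seteqP; split=> z /=.
  by move=> zk; rewrite -bigcap_seq => i _ /=; rewrite in_itv/=; exact: zk.
rewrite -bigcap_seq => + i => /(_ i); rewrite /= in_itv/=; apply.
by rewrite mem_index_enum.
Qed.

Lemma measurable_majorant : measurable_fun [set: 'cV[R]_d * 'cV[R]_d] majorant.
Proof.
apply: ge0_emeasurable_sum => [k z _ _|k _]; first exact: majorant_term_ge0.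
apply/measurable_EFinP; apply: measurable_funM => //.
by apply: measurable_indic; exact: measurable_cube_nbhs.
Qed.

Lemma cube_nbhs_slice k x :
  xsection (cube_nbhs k) x =
  cV_box (x - const_mx (2^-1 ^+ k)) (x + const_mx (2^-1 ^+ k)).
Proof.
apply/seteqP; split=> y; rewrite /xsection/= ?inE/= => + i => /(_ i);
  by rewrite !mxE ler_distl.
Qed.

Lemma cube_nbhs_slice_volume k x :
  mu (xsection (cube_nbhs k) x) = ((2 * 2^-1 ^+ k) ^+ d)%:E.
Proof.
rewrite cube_nbhs_slice lebesgue_cV_box => [|i].
  congr EFin; rewrite -[d in RHS]card_ord -prodr_const.
  by apply: eq_bigr => i _; rewrite !mxE; ring.
by rewrite !mxE lerD2l ge0_cp// exprn_ge0.
Qed.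

(** This is where the dimension enters: halving the side of a cube divides its
    volume by at least 4, so the weights 3 ^+ k are summable. *)
Lemma integral_majorant x : (2 <= d)%N ->
  (\int[mu]_y majorant (x, y) <= (2 ^+ d * 4)%:E)%E.
Proof.
move=> d2; rewrite integral_nneseries//; last first.
  move=> k; apply/measurable_EFinP; apply: measurable_funM => //.
  by apply: measurable_fun_pair2; apply: measurable_indic; exact: measurable_cube_nbhs.
apply: nneseries_le => [k|n].
  by apply: integral_ge0 => y _; exact: majorant_term_ge0.
apply: (@le_trans _ _ (\sum_(0 <= k < n) (2 ^+ d * (3 / 4) ^+ k)%:E)%E).
  apply: lee_sum => k _.
  have -> : (fun y => (3 ^+ k * \1_(cube_nbhs k) (x, y))%:E) =
      (fun y => ((3 : R) ^+ k)%:E * (\1_(xsection (cube_nbhs k) x) y)%:E)%E.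
    apply/funext => y; rewrite -EFinM; congr (_ * _)%:E.
    by rewrite !indicE; congr (nat_of_bool _)%:R; apply/idP/idP; rewrite !inE /xsection/= inE.
  rewrite ge0_integralZl_EFin ?exprn_ge0//; last first.
    apply/measurable_EFinP; apply: measurable_indic.
    by apply: measurable_xsection; exact: measurable_cube_nbhs.
  rewrite integral_indic ?setIT//; last first.
    by apply: measurable_xsection; exact: measurable_cube_nbhs.
  rewrite [X in (_ * X)%E]cube_nbhs_slice_volume lee_fin exprMn mulrCA ler_pM2l ?exprn_gt0//.
  rewrite exprMn ler_pM2l ?exprn_gt0// -exprM mulnC exprM.
  rewrite lerXn2r ?nnegrE ?exprn_ge0//.
  have -> : (4^-1 : R) = 2^-1 ^+ 2 by field.
  by rewrite ler_wiXn2l// invf_le1// ler1n.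
rewrite sumEFin lee_fin -mulr_sumr ler_pM2l ?exprn_gt0//.
suff -> : \sum_(0 <= k < n) (3 / 4 : R) ^+ k = 4 - 4 * (3 / 4) ^+ n.
  by rewrite gerBl mulr_ge0// exprn_ge0.
elim: n => [|n IH]; first by rewrite big_nil expr0; ring.
by rewrite big_nat_recr//= IH exprS; field.
Qed.

(** At distance about 2 ^- k the left side is at most 2 * 2 ^+ k * t. If t is at
    most (3 / 2) ^+ k, the weight 3 ^+ k of the majorant covers it; otherwise
    2 ^+ k <= t ^+ 2, and t ^+ 3 does. *)
Lemma inverse_distance_majorant x y (t : R) : 0 <= t ->
  ((t / enorm (y - x))%:E <= 2%:E * majorant (x, y) + (2 * t ^+ 3 + 1)%:E)%E.
Proof.
move=> t0; set r := enorm (y - x).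
have t1 : t <= 2 * t ^+ 3 + 1.
  rewrite -subr_ge0.
  have -> : 2 * t ^+ 3 + 1 - t = (t + 1) * (t ^+ 2 + (t - 1) ^+ 2) by ring.
  by rewrite mulr_ge0 ?addr_ge0 ?sqr_ge0.
have k0 := majorant_ge0 (x, y).
have [r1|r1] := leP 1 r.
  rewrite (le_trans _ (leeDr _ _)) ?mule_ge0// lee_fin (le_trans _ t1)//.
  by rewrite ler_piMr// invf_le1// (lt_le_trans _ r1).
have [r0|/eqP r0] := eqVneq r 0.
  by rewrite r0 invr0 mulr0 adde_ge0 ?mule_ge0// lee_fin (le_trans _ t1).
have {}r0 : 0 < r by rewrite lt_neqAle enorm_ge0 andbT eq_sym; exact/eqP.
have [k /andP[kr rk]] := dyadic_scale r0 (ltW r1).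
have r2 : t / r <= 2 * 2 ^+ k * t.
  rewrite mulrC ler_wpM2r// -exprS -[_ ^+ k.+1]invrK -exprVn lef_pV2 ?posrE//.
  exact: ltW.
have [tk|tk] := leP t ((3 / 2) ^+ k).
  have : ((3 ^+ k)%:E <= majorant (x, y))%E.
    apply: le_trans (nneseries_ge k (fun j => majorant_term_ge0 j _)).
    rewrite lee_fin indicE mem_set ?mulr1// => i /=.
    by rewrite (le_trans _ rk)// (le_trans _ (coord_le_enorm _ i))// !mxE.
  move=> /(lee_wpmul2l (lee0n 2)) k3.
  rewrite -[leLHS]adde0; apply: leeD; last by rewrite lee_fin (le_trans _ t1).
  apply: le_trans k3; rewrite -EFinM lee_fin (le_trans r2)// -mulrA ler_pM2l//.
  rewrite (le_trans (ler_wpM2l _ tk)) ?exprn_ge0// -exprMn.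
  by have -> : (2 : R) * (3 / 2) = 3 by field.
rewrite (le_trans _ (leeDr _ _)) ?mule_ge0// lee_fin (le_trans r2)//.
have : 2 ^+ k <= t ^+ 2.
  rewrite (@le_trans _ _ (((3 / 2) ^+ k) ^+ 2))//; last first.
    by rewrite ler_pXn2r ?nnegrE ?exprn_ge0// ltW.
  by rewrite -exprM mulnC exprM lerXn2r ?nnegrE ?exprn_ge0//; lra.
by nra.
Qed.

End dyadic_majorant.
(** * Integral operators with a weakly singular kernel *)

Lemma Rintegral_sum (disp : measure_display) (T : measurableType disp)
    (R : realType) (nu : {measure set T -> \bar R}) (I : Type) (s : seq I)
    (F : I -> T -> R) :
  (forall i, nu.-integrable setT (EFin \o F i)) ->
  \int[nu]_x (\sum_(i <- s) F i x) = \sum_(i <- s) \int[nu]_x F i x.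
Proof.
move=> iF; rewrite /Rintegral.
under eq_integral do rewrite -sumEFin.
rewrite integral_sum// -sum_fine// => i _.
by apply: integrable_fin_num => //; exact: iF.
Qed.

Lemma le_integrable_ereal (disp : measure_display) (T : measurableType disp)
    (R : realType) (nu : {measure set T -> \bar R}) (F : T -> R) (G : T -> \bar R) :
  measurable_fun [set: T] F -> measurable_fun [set: T] G ->
  (forall x, `|F x|%:E <= G x)%E -> (\int[nu]_x G x < +oo)%E ->
  nu.-integrable setT (EFin \o F).
Proof.
move=> mF mG FG Goo.
have mF' : measurable_fun [set: T] (EFin \o F) by exact/measurable_EFinP.
apply/integrableP; split=> //; apply: le_lt_trans Goo.
apply: ge0_le_integral => //; first exact: measurableT_comp.
by move=> x _ /=; exact: FG.
Qed.

Section singular_kernel.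
Context {R : realType} (d : nat).
Implicit Types (x y : 'cV[R]_d) (f phi : 'cV[R]_d -> 'cV[R]_d).
Local Notation mu := (lebesgue_cV R d).
Local Notation V := 'cV[R]_d.

Hypothesis d2 : (2 <= d)%N.
Variables (Omega : set 'cV[R]_d) (mOmega : measurable Omega).
Hypothesis finOmega : (mu Omega < +oo)%E.
Variables (a : 'cV[R]_d -> 'cV[R]_d -> R) (C : R).
Hypothesis C0 : 0 <= C.
Hypothesis ma : measurable_fun [set: V * V] (fun z : V * V => a z.1 z.2).
Hypothesis asym : forall x y, a x y = a y x.
Hypothesis a_le : forall x y,
  `|a x y| <= \1_Omega x * \1_Omega y * (C / enorm (y - x)).

(* An upper bound of the integral over y in Omega of 2 * majorant (x, y) + 3. *)
Let K : R := 2 * (2 ^+ d * 4) + 3 * fine (mu Omega).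

Let K0 : 0 <= K.
Proof. by rewrite addr_ge0 ?mulr_ge0 ?exprn_ge0 ?fine_ge0. Qed.

Section dominated_kernel.
(** The inequality inverse_distance_majorant bounds |a| * t by an integrable
    function plus t ^+ 3. So a function bounded by |a| * t is integrable in y, or
    in both variables, when the cube of t is controlled by a function of x and an
    integrable function of y, or by integrable functions of both. *)
Variables (P Q : 'cV[R]_d -> R).
Hypotheses (mP : measurable_fun setT P) (mQ : measurable_fun setT Q).
Hypotheses (P0 : forall x, 0 <= P x) (Q0 : forall x, 0 <= Q x).
Hypotheses (Qoo : (\int[mu]_y (Q y)%:E < +oo)%E).
Variables (t F : V * V -> R).
Hypothesis mF : measurable_fun [set: V * V] F.
Hypothesis t0 : forall z, 0 <= t z.
Hypothesis tPQ : forall x y, t (x, y) ^+ 3 <= P x + Q y + 1.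
Hypothesis Ft : forall x y, `|F (x, y)| <= `|a x y| * t (x, y).

Let IQ : R := \int[mu]_y Q y.

Let IQ0 : 0 <= IQ.
Proof. by apply: fine_ge0; apply: integral_ge0 => y _; rewrite lee_fin. Qed.

Let IQE : (\int[mu]_y (Q y)%:E)%E = IQ%:E.
Proof.
by rewrite /IQ fineK// ge0_fin_numE ?integral_ge0// => y _; rewrite lee_fin.
Qed.

Let bnd (z : V * V) : \bar R := ((C * \1_Omega z.1)%:E *
  (2%:E * majorant z + (\1_Omega z.2 * (2 * P z.1 + 3) + 2 * Q z.2)%:E))%E.

Let mind : measurable_fun [set: V] (\1_Omega : V -> R).
Proof. exact: measurable_indic. Qed.

Let ind01 x : 0 <= (\1_Omega x : R) <= 1.
Proof. by rewrite indicE; case: (_ \in _); rewrite /= ?lexx ?ler01. Qed.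

Let rest0 z : 0 <= (\1_Omega z.2 * (2 * P z.1 + 3) + 2 * Q z.2).
Proof.
have /andP[i0 _] := ind01 z.2.
by rewrite addr_ge0 ?mulr_ge0 ?addr_ge0 ?mulr_ge0.
Qed.

Let mrest : measurable_fun [set: V * V]
  (fun z => (\1_Omega z.2 * (2 * P z.1 + 3) + 2 * Q z.2)).
Proof.
apply: measurable_funD; apply: measurable_funM => //.
- exact: measurableT_comp.
- apply: measurable_funD => //; apply: measurable_funM => //.
  exact: measurableT_comp.
- exact: measurableT_comp.
Qed.

Let bnd0 z : (0 <= bnd z)%E.
Proof.
have /andP[i0 _] := ind01 z.1.
rewrite mule_ge0 ?lee_fin ?mulr_ge0// adde_ge0 ?mule_ge0 ?majorant_ge0//.
by rewrite lee_fin.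
Qed.

Let mbnd : measurable_fun [set: V * V] bnd.
Proof.
apply: emeasurable_funM.
  apply/measurable_EFinP; apply: measurable_funM => //.
  exact: measurableT_comp.
apply: emeasurable_funD; last exact/measurable_EFinP.
by apply: emeasurable_funM => //; exact: measurable_majorant.
Qed.

Let F_bnd z : (`|F z|%:E <= bnd z)%E.
Proof.
case: z => x y; apply: (@le_trans _ _
    ((C * \1_Omega x * \1_Omega y)%:E * (t (x, y) / enorm (y - x))%:E)%E).
  rewrite -EFinM lee_fin (le_trans (Ft _ _))//.
  rewrite (le_trans (ler_wpM2r (t0 _) (a_le x y)))//.
  by rewrite le_eqVlt; apply/orP; left; apply/eqP; ring.
have /andP[ix0 ix1] := ind01 x; have /andP[iy0 iy1] := ind01 y.
rewrite EFinM -muleA /bnd/= lee_wpmul2l ?lee_fin ?mulr_ge0//.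
have k0 := majorant_ge0 (x, y).
have r0 := rest0 (x, y).
rewrite indicE; case: (boolP (y \in Omega)) => /= yO; last first.
  rewrite mul0e mul0r add0r adde_ge0 ?mule_ge0//.
  by rewrite lee_fin mulr_ge0.
rewrite mul1e (le_trans (inverse_distance_majorant x y (t0 _)))//.
rewrite leeD2l// lee_fin mul1r.
by have := tPQ x y; lra.
Qed.

Let bnd_slice x :
  (\int[mu]_y bnd (x, y) <=
   (C * \1_Omega x * (K + 2 * IQ + 2 * fine (mu Omega) * P x))%:E)%E.
Proof.
have /andP[i0 _] := ind01 x.
have Ofin : mu Omega \is a fin_num by rewrite ge0_fin_numE.
have mk : measurable_fun [set: V] (fun y => majorant (x, y)).
  by apply: measurable_fun_pair2; exact: measurable_majorant.
have mr : measurable_fun [set: V]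
    (fun y => (\1_Omega y * (2 * P x + 3) + 2 * Q y)%:E).
  by apply/measurable_EFinP; exact: (measurable_fun_pair2 x mrest).
rewrite /bnd/= ge0_integralZl_EFin ?mulr_ge0//; last 2 first.
- by move=> y _; rewrite adde_ge0 ?mule_ge0 ?majorant_ge0// lee_fin (rest0 (x, y)).
- by apply: emeasurable_funD => //; exact: emeasurable_funM.
rewrite [leRHS]EFinM lee_wpmul2l ?lee_fin ?mulr_ge0//.
rewrite ge0_integralD//; last 3 first.
- by move=> y _; rewrite mule_ge0 ?majorant_ge0.
- exact: emeasurable_funM.
- by move=> y _; rewrite lee_fin (rest0 (x, y)).
rewrite ge0_integralZl_EFin//; last by move=> y _; exact: majorant_ge0.
have -> : (\int[mu]_y (\1_Omega y * (2 * P x + 3) + 2 * Q y)%:E =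
   (fine (mu Omega) * (2 * P x + 3) + 2 * IQ)%:E)%E.
  under eq_integral do rewrite EFinD EFinM (EFinM 2).
  rewrite ge0_integralD//; last 4 first.
  - move=> y _; rewrite mule_ge0// lee_fin ?addr_ge0 ?mulr_ge0//.
  - by apply: emeasurable_funM => //; exact/measurable_EFinP.
  - by move=> y _; rewrite mule_ge0// lee_fin.
  - by apply: emeasurable_funM => //; exact/measurable_EFinP.
  rewrite ge0_integralZr//; last 2 first.
  - exact/measurable_EFinP.
  - by rewrite lee_fin ?addr_ge0 ?mulr_ge0.
  rewrite integral_indic// setIT ge0_integralZl_EFin//; last 2 first.
  - by move=> y _; rewrite lee_fin.
  - exact/measurable_EFinP.
  by rewrite -[X in (X * _ + _)%E](fineK Ofin) IQE -!EFinM -EFinD.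
rewrite [leRHS](_ : _ = ((2 * (2 ^+ d * 4))%:E +
  (fine (mu Omega) * (2 * P x + 3) + 2 * IQ)%:E)%E); last first.
  by rewrite -EFinD /K; congr EFin; ring.
by rewrite leeD2r// EFinM lee_wpmul2l// integral_majorant.
Qed.

Lemma integrable_kernel_slice x :
  mu.-integrable setT (fun y => (F (x, y))%:E).
Proof.
apply: (@le_integrable_ereal _ _ _ mu (fun y => F (x, y)) (fun y => bnd (x, y))).
- exact: measurable_fun_pair2.
- exact: measurable_fun_pair2.
- by move=> y; exact: F_bnd.
- exact: le_lt_trans (bnd_slice x) (ltry _).
Qed.

(** The bound depends on x only through P, hence is uniform when P is 0. *)
Lemma kernel_slice_le x : `|\int[mu]_y F (x, y)| <=
  C * (K + 2 * IQ + 2 * fine (mu Omega) * P x).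
Proof.
have /andP[i0 i1] := ind01 x.
rewrite (@le_trans _ _ (C * \1_Omega x * (K + 2 * IQ
    + 2 * fine (mu Omega) * P x)))//; last first.
  rewrite ler_wpM2r//; last by rewrite ler_piMr.
  apply: addr_ge0; first by rewrite addr_ge0 ?mulr_ge0.
  by rewrite !mulr_ge0 ?fine_ge0.
rewrite -lee_fin EFin_normr_Rintegral//; last exact: integrable_kernel_slice.
apply: le_trans (bnd_slice x); apply: le_trans (le_abse_integral _ _ _) _ => //.
  by apply/measurable_EFinP; exact: measurable_fun_pair2.
apply: ge0_le_integral => //.
- apply: measurableT_comp => //; apply/measurable_EFinP.
  exact: measurable_fun_pair2.
- exact: measurable_fun_pair2.
- by move=> y _; exact: F_bnd.
Qed.

Hypotheses (Poo : (\int[mu]_y (P y)%:E < +oo)%E).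

Lemma integrable_kernel : (mu \x mu)%E.-integrable setT (EFin \o F).
Proof.
apply: (le_integrable_ereal mF mbnd F_bnd).
rewrite fubini_tonelli1//.
pose k1 := C * (K + 2 * IQ).
pose k2 := C * (2 * fine (mu Omega)).
have k10 : 0 <= k1 by rewrite mulr_ge0// addr_ge0// mulr_ge0.
have k20 : 0 <= k2 by apply: mulr_ge0 => //; rewrite mulr_ge0 ?fine_ge0.
apply: (@le_lt_trans _ _ (\int[mu]_x (k1%:E * (\1_Omega x)%:E + k2%:E * (P x)%:E))%E).
  apply: ge0_le_integral => //.
  - by move=> x _; apply: integral_ge0.
  - exact: (measurable_fun_fubini_tonelli_F bnd).
  - apply: emeasurable_funD; apply: emeasurable_funM => //; exact/measurable_EFinP.
  - move=> x _; apply: le_trans (bnd_slice x) _.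
    have /andP[i0 i1] := ind01 x.
    rewrite -!EFinM -EFinD lee_fin mulrDr /k1 /k2 lerD//.
      by rewrite le_eqVlt; apply/orP; left; apply/eqP; ring.
    have ->: C * \1_Omega x * (2 * fine (mu Omega) * P x) =
      (C * (2 * fine (mu Omega)) * P x) * \1_Omega x by ring.
    by rewrite ler_piMr// mulr_ge0.
rewrite ge0_integralD//; last 4 first.
- by move=> x _; have /andP[i0 i1] := ind01 x; rewrite mule_ge0 ?lee_fin.
- by apply: emeasurable_funM => //; exact/measurable_EFinP.
- by move=> x _; rewrite mule_ge0 ?lee_fin.
- by apply: emeasurable_funM => //; exact/measurable_EFinP.
rewrite !ge0_integralZl_EFin//; last 3 first.
- by move=> y _; rewrite lee_fin.
- exact/measurable_EFinP.
- exact/measurable_EFinP.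
rewrite integral_indic// setIT lte_add_pinfty//; exact: lte_mul_pinfty.
Qed.

End dominated_kernel.

(** The matrix that multiplies f x once the difference f y - f x is split; for
    the kernel of the linearized operator it is the stability tensor. *)
Definition coupling x : 'M[R]_d := \matrix_(i, j)
  \int[mu]_y (a x y * direction y x j 0 * direction y x i 0).

Definition averaging f x : V := \col_i
  \int[mu]_y (a x y * dotp (f y) (direction y x) * direction y x i 0).

Definition singular_op f x : V := - \col_i \int[mu]_y
  (a x y * dotp (f y - f x) (direction y x) * direction y x i 0).

Let mdir : measurable_fun [set: V * V] (fun z : V * V => direction z.2 z.1).
Proof. by apply: measurable_direction. Qed.

Let mdot (f : V * V -> V) : measurable_fun [set: V * V] f ->
  measurable_fun [set: V * V]
    (fun z => a z.1 z.2 * dotp (f z) (direction z.2 z.1)).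
Proof.
move=> mf; apply: measurable_funM; first exact: ma.
exact: measurable_dotp.
Qed.

Let cst0_oo : (\int[mu]_y (cst 0 y)%:E < +oo)%E.
Proof. by rewrite integral0. Qed.

Let le_dir x y i (s t : R) : `|s| <= t -> `|s * direction y x i 0| <= t.
Proof.
by move=> st; rewrite normrM (le_trans _ st)// ler_piMr// direction_le1.
Qed.

Let le_dotp x y b : `|a x y * dotp b (direction y x)| <= `|a x y| * norm1 b.
Proof. by rewrite normrM ler_wpM2l// dotp_direction_le. Qed.

Section averaging.
Variables (f : V -> V) (i : 'I_d).
Hypothesis fL6 : L6 f.

Let P : V -> R := cst 0.
Let Q y := norm1 (f y) ^+ 6.
Let t (z : V * V) := norm1 (f z.2).
Let F (z : V * V) : R :=
  a z.1 z.2 * dotp (f z.2) (direction z.2 z.1) * direction z.2 z.1 i 0.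

Let mQ : measurable_fun [set: V] Q.
Proof. by apply: measurable_norm1_6; case: fL6. Qed.

Let Q0 y : 0 <= Q y.
Proof. by rewrite exprn_ge0 ?norm1_ge0. Qed.

Let mF : measurable_fun [set: V * V] F.
Proof.
apply: measurable_funM; last exact: (measurable_coord i mdir).
by apply: mdot; apply: measurableT_comp => //; case: fL6.
Qed.

Let t0 z : 0 <= t z.
Proof. exact: norm1_ge0. Qed.

Let tQ x y : t (x, y) ^+ 3 <= P x + Q y + 1.
Proof. by rewrite add0r cube_le_sixth ?norm1_ge0. Qed.

Let F_le x y : `|F (x, y)| <= `|a x y| * t (x, y).
Proof. by rewrite le_dir ?le_dotp. Qed.

Lemma integrable_averaging x : mu.-integrable setT
  (fun y => (a x y * dotp (f y) (direction y x) * direction y x i 0)%:E).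
Proof.
by apply: (@integrable_kernel_slice P Q _ _ _ _ _ t F) => //; case: fL6.
Qed.

(** Averaging gains boundedness: the kernel is integrable to a power above 1,
    and the field to a high power. *)
Lemma averaging_coord_bounded : exists M, forall x, `|averaging f x i 0| <= M.
Proof.
exists (C * (K + 2 * \int[mu]_y Q y)) => x; rewrite mxE.
(* The term of kernel_slice_le in P, which is 0, is put back. *)
rewrite -[leRHS](congr1 ( *%R C) (addr0 _)) -[X in _ + X](mulr0 (2 * fine (mu Omega))).
by apply: (@kernel_slice_le P Q _ _ _ _ _ t F) => //; case: fL6.
Qed.

Lemma measurable_averaging_coord :
  measurable_fun [set: V] (fun x => averaging f x i 0).
Proof.
under eq_fun do rewrite mxE.
apply: (measurableT_comp (f := fine)); first exact: fine_measurable.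
apply: (@measurable_fubini_F _ _ V V R mu mu (EFin \o F)).
by apply: (@integrable_kernel P Q _ _ _ _ _ t F) => //; case: fL6.
Qed.

End averaging.

Section coupling.
Variables i j : 'I_d.

Let F (z : V * V) : R :=
  a z.1 z.2 * direction z.2 z.1 j 0 * direction z.2 z.1 i 0.

Let mF : measurable_fun [set: V * V] F.
Proof.
apply: measurable_funM; last exact: (measurable_coord i mdir).
by apply: measurable_funM; [exact: ma|exact: (measurable_coord j mdir)].
Qed.

Let F_le x y : `|F (x, y)| <= `|a x y| * 1.
Proof. by rewrite mulr1 /F/=; do 2 apply: le_dir. Qed.

Lemma integrable_coupling x : mu.-integrable setT
  (fun y => (a x y * direction y x j 0 * direction y x i 0)%:E).
Proof.
apply: (@integrable_kernel_slice (cst 0) (cst 0) _ _ _ _ _ (cst 1) F) => //=.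
by move=> x' y'; rewrite expr1n !add0r.
Qed.

Lemma coupling_entry_bounded : exists M, forall x, `|coupling x i j| <= M.
Proof.
exists (C * K) => x; rewrite mxE.
have -> : C * K = C * (K + 2 * \int[mu]_y (cst 0 y) + 2 * fine (mu Omega) * cst 0 x).
  by rewrite Rintegral_cst// !(mul0r, mulr0) !addr0.
apply: (@kernel_slice_le (cst 0) (cst 0) _ _ _ _ _ (cst 1) F) => //=.
by move=> x' y'; rewrite expr1n !add0r.
Qed.

Lemma measurable_coupling_entry : measurable_fun [set: V] (fun x => coupling x i j).
Proof.
under eq_fun do rewrite mxE; 
apply: (measurableT_comp (f := fine)); first exact: fine_measurable.
apply: (@measurable_fubini_F _ _ V V R mu mu (EFin \o F)).
apply: (@integrable_kernel (cst 0) (cst 0) _ _ _ _ _ (cst 1) _) => //=.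
by move=> x' y'; rewrite expr1n !add0r.
Qed.

End coupling.

Lemma integrable_coupling_dotp x b i : mu.-integrable setT
  (fun y => (a x y * dotp b (direction y x) * direction y x i 0)%:E).
Proof.
have -> : (fun y => (a x y * dotp b (direction y x) * direction y x i 0)%:E) =
    (fun y => \sum_(j < d)
       (b j 0)%:E * (a x y * direction y x j 0 * direction y x i 0)%:E)%E.
  apply/funext => y; rewrite mulr_sumr mulr_suml -sumEFin.
  by apply: eq_bigr => j _; rewrite -EFinM; congr EFin; ring.
apply: integrable_sum => // j _; apply: integrableZl => //.
exact: integrable_coupling.
Qed.

Lemma coupling_mulE x b i : (coupling x *m b) i 0 =
  \int[mu]_y (a x y * dotp b (direction y x) * direction y x i 0).
Proof.
rewrite mxE.
transitivity (\int[mu]_y \sum_(j < d)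
    b j 0 * (a x y * direction y x j 0 * direction y x i 0)); last first.
  apply: eq_Rintegral => y _; rewrite mulr_sumr mulr_suml.
  by apply: eq_bigr => j _; ring.
rewrite Rintegral_sum; last first.
  by move=> j; exact: (integrableZl measurableT (b j 0) (integrable_coupling i j x)).
apply: eq_bigr => j _; rewrite mxE RintegralZl ?(mulrC (b j 0))//.
exact: integrable_coupling.
Qed.

Lemma integrable_singular_op f x i : L6 f -> mu.-integrable setT
  (fun y => (a x y * dotp (f y - f x) (direction y x) * direction y x i 0)%:E).
Proof.
move=> fL6.
have -> : (fun y => (a x y * dotp (f y - f x) (direction y x) * direction y x i 0)%:E) =
  (fun y => (a x y * dotp (f y) (direction y x) * direction y x i 0)%:E -
    (a x y * dotp (f x) (direction y x) * direction y x i 0)%:E)%E.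
  apply/funext => y; rewrite -EFinB; congr EFin.
  by rewrite dotpBl; ring.
by apply: integrableB => //; [exact: integrable_averaging|
  exact: integrable_coupling_dotp].
Qed.

(** Splitting the difference f y - f x isolates the only term that may be
    unbounded, the product by the coupling matrix. *)
Lemma singular_opE f x : L6 f ->
  singular_op f x = coupling x *m f x - averaging f x.
Proof.
move=> fL6; apply/colP => i; rewrite [RHS]mxE coupling_mulE !mxE -opprB; congr (- _).
rewrite -RintegralB//; last 2 first.
- exact: integrable_averaging.
- exact: integrable_coupling_dotp.
by apply: eq_Rintegral => y _; rewrite dotpBl; ring.
Qed.

Lemma measurable_singular_op f : L6 f -> measurable_fun [set: V] (singular_op f).
Proof.
move=> fL6; apply/measurable_fun_coorP => i.
under eq_fun do rewrite singular_opE// mxE [X in X + _]mxE [X in _ + X]mxE.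
apply: measurable_funB; last exact: measurable_averaging_coord.
apply: measurable_sum => j; apply: measurable_funM.
  exact: measurable_coupling_entry.
by apply: measurable_coord; case: fL6.
Qed.

Lemma singular_opB f h x : L6 f -> L6 h ->
  singular_op (fun x => f x - h x) x = singular_op f x - singular_op h x.
Proof.
move=> fL6 hL6; apply/colP => i; rewrite !mxE -opprD; congr (- _).
rewrite -RintegralB//; last 2 first.
- exact: integrable_singular_op.
- exact: integrable_singular_op.
apply: eq_Rintegral => y _.
have -> : f y - h y - (f x - h x) = f y - f x - (h y - h x)
  by rewrite !opprD !opprK addrACA.
by rewrite [in LHS]dotpBl; ring.
Qed.

Definition diagonal_form f phi (z : V * V) : R := a z.1 z.2 *
  dotp (f z.1) (direction z.2 z.1) * dotp (phi z.1) (direction z.2 z.1).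

Definition cross_form f phi (z : V * V) : R := a z.1 z.2 *
  dotp (f z.2) (direction z.2 z.1) * dotp (phi z.1) (direction z.2 z.1).

Definition diagonal_term f phi x := \int[mu]_y diagonal_form f phi (x, y).

Definition cross_term f phi x := \int[mu]_y cross_form f phi (x, y).

Section symmetry.
Variables f phi : V -> V.
Hypotheses (fL6 : L6 f) (phiL6 : L6 phi).

Let P x := norm1 (f x) ^+ 6 + norm1 (phi x) ^+ 6.

Let P0 x : 0 <= P x.
Proof. by rewrite addr_ge0 ?exprn_ge0 ?norm1_ge0. Qed.

Let mP : measurable_fun [set: V] P.
Proof.
by apply: measurable_funD; apply: measurable_norm1_6; [case: fL6|case: phiL6].
Qed.

Let Poo : (\int[mu]_x (P x)%:E < +oo)%E.
Proof.
have [[mf foo] [mphi phioo]] := (fL6, phiL6).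
under eq_integral do rewrite EFinD.
rewrite ge0_integralD//; first exact: lte_add_pinfty.
- by move=> x _; rewrite lee_fin exprn_ge0 ?norm1_ge0.
- by apply/measurable_EFinP; exact: measurable_norm1_6.
- by move=> x _; rewrite lee_fin exprn_ge0 ?norm1_ge0.
- by apply/measurable_EFinP; exact: measurable_norm1_6.
Qed.

Lemma integrable_diagonal_form :
  (mu \x mu)%E.-integrable setT (EFin \o diagonal_form f phi).
Proof.
have [[mf foo] [mphi phioo]] := (fL6, phiL6).
apply: (@integrable_kernel P P _ _ _ _ _
  (fun z => norm1 (f z.1) * norm1 (phi z.1))) => //=.
- apply: measurable_funM; first by apply: mdot; exact: measurableT_comp.
  by apply: measurable_dotp => //; exact: measurableT_comp.
- by move=> z; rewrite mulr_ge0 ?norm1_ge0.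
- move=> x y; rewrite (le_trans (mul_cube_le_sixth _ _))//.
  by rewrite -/(P x); have := P0 y; lra.
- by move=> x y; rewrite /diagonal_form/= -mulrA normrM ler_wpM2l// normrM ler_pM// dotp_direction_le.
Qed.

Lemma integrable_cross_form :
  (mu \x mu)%E.-integrable setT (EFin \o cross_form f phi).
Proof.
have [[mf foo] [mphi phioo]] := (fL6, phiL6).
apply: (@integrable_kernel P P _ _ _ _ _
  (fun z => norm1 (f z.2) * norm1 (phi z.1))) => //=.
- apply: measurable_funM; first by apply: mdot; exact: measurableT_comp.
  by apply: measurable_dotp => //; exact: measurableT_comp.
- by move=> z; rewrite mulr_ge0 ?norm1_ge0.
- move=> x y; rewrite (le_trans (mul_cube_le_sixth _ _))// /P.
  have := exprn_ge0 6 (norm1_ge0 (f x)).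
  by have := exprn_ge0 6 (norm1_ge0 (phi y)); lra.
- by move=> x y; rewrite /cross_form/= -mulrA normrM ler_wpM2l// normrM ler_pM// dotp_direction_le.
Qed.

Lemma integrable_cross_slice x :
  mu.-integrable setT (fun y => (cross_form f phi (x, y))%:E).
Proof.
have -> : (fun y => (cross_form f phi (x, y))%:E) =
    (fun y => \sum_(i < d) (phi x i 0)%:E *
      (a x y * dotp (f y) (direction y x) * direction y x i 0)%:E)%E.
  apply/funext => y; rewrite /cross_form/= mulr_sumr -sumEFin.
  by apply: eq_bigr => j _; rewrite -EFinM; congr EFin; ring.
apply: integrable_sum => // j _; apply: integrableZl => //.
exact: integrable_averaging.
Qed.

Lemma integrable_diagonal_slice x :
  mu.-integrable setT (fun y => (diagonal_form f phi (x, y))%:E).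
Proof.
have -> : (fun y => (diagonal_form f phi (x, y))%:E) =
    (fun y => \sum_(i < d) (phi x i 0)%:E *
      (a x y * dotp (f x) (direction y x) * direction y x i 0)%:E)%E.
  apply/funext => y; rewrite /diagonal_form/= mulr_sumr -sumEFin.
  by apply: eq_bigr => j _; rewrite -EFinM; congr EFin; ring.
apply: integrable_sum => // j _; apply: integrableZl => //.
exact: integrable_coupling_dotp.
Qed.

Lemma dotp_singular_op x : dotp (singular_op f x) (phi x) =
  diagonal_term f phi x - cross_term f phi x.
Proof.
rewrite -RintegralB//; last 2 first.
- exact: integrable_diagonal_slice.
- exact: integrable_cross_slice.
transitivity (\int[mu]_y \sum_(i < d) - phi x i 0 *
   (a x y * dotp (f y - f x) (direction y x) * direction y x i 0)).
  rewrite Rintegral_sum; last first.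
    move=> i; exact: (integrableZl measurableT (- phi x i 0)
      (integrable_singular_op x i fL6)).
  apply: eq_bigr => i _; rewrite !mxE RintegralZl//; last first.
    exact: integrable_singular_op.
  by rewrite mulrC !mulNr mulrN.
apply: eq_Rintegral => y _.
transitivity (- (a x y * dotp (f y - f x) (direction y x)) *
    dotp (phi x) (direction y x)); last first.
  by rewrite /diagonal_form /cross_form/= dotpBl; ring.
move: (dotp (f y - f x) _) => D; rewrite [dotp (phi x) _]/dotp mulr_sumr.
by apply: eq_bigr => i _; ring.
Qed.

Lemma cross_termE x : (cross_term f phi x)%:E =
  fubini_F mu (EFin \o cross_form f phi) x.
Proof.
rewrite /fubini_F /cross_term /Rintegral fineK// integrable_fin_num//.
exact: integrable_cross_slice.
Qed.

Lemma integrable_cross_term : mu.-integrable setT (EFin \o cross_term f phi).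
Proof.
have := integrable_fubini_F integrable_cross_form.
by apply: eq_integrable => // x _ /=; rewrite cross_termE.
Qed.

Lemma integrable_diagonal_term : mu.-integrable setT (EFin \o diagonal_term f phi).
Proof.
have := integrable_fubini_F integrable_diagonal_form.
apply: eq_integrable => // x _ /=.
rewrite /fubini_F /diagonal_term /Rintegral fineK//.
by rewrite integrable_fin_num//; exact: integrable_diagonal_slice.
Qed.

Lemma integral_dotp_singular_op :
  \int[mu]_x dotp (singular_op f x) (phi x) =
  \int[mu]_x diagonal_term f phi x - \int[mu]_x cross_term f phi x.
Proof.
under eq_Rintegral do rewrite dotp_singular_op.
by rewrite RintegralB//; [exact: integrable_diagonal_term|
  exact: integrable_cross_term].
Qed.

End symmetry.

(** Exchanging the variables, by Fubini, leaves the kernel and the product of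
    the two directions unchanged. *)
Lemma integral_cross_termC f phi : L6 f -> L6 phi ->
  \int[mu]_x cross_term f phi x = \int[mu]_x cross_term phi f x.
Proof.
move=> fL6 phiL6; apply: (congr1 fine).
transitivity (\int[mu]_x fubini_F mu (EFin \o cross_form f phi) x)%E.
  by apply: eq_integral => x _; rewrite cross_termE.
apply: (etrans (Fubini (integrable_cross_form fL6 phiL6))).
apply: eq_integral => y _; rewrite [RHS](cross_termE f phiL6).
apply: eq_integral => x _ /=; congr EFin.
by rewrite /cross_form/= asym directionC !dotpNr; ring.
Qed.

Lemma singular_op_sym f phi : L6 f -> L6 phi ->
  \int[mu]_x dotp (singular_op f x) (phi x) =
  \int[mu]_x dotp (f x) (singular_op phi x).
Proof.
move=> fL6 phiL6; under [RHS]eq_Rintegral do rewrite dotpC.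
rewrite (integral_dotp_singular_op fL6 phiL6).
rewrite (integral_dotp_singular_op phiL6 fL6) (integral_cross_termC fL6 phiL6).
apply: (congr1 (fun I => I - _)).
apply: eq_Rintegral => x _; apply: eq_Rintegral => y _.
by rewrite /diagonal_form; ring.
Qed.

Let a_out x y : ~ (Omega x /\ Omega y) -> a x y = 0.
Proof.
move=> xy; apply/eqP; rewrite -normr_le0 (le_trans (a_le x y))// !indicE.
have [xO|xO] := boolP (x \in Omega); last by rewrite !mul0r.
have [yO|yO] := boolP (y \in Omega); last by rewrite mulr0 mul0r.
by exfalso; apply: xy; split; exact: set_mem.
Qed.

Lemma singular_op_out f x : ~ Omega x -> singular_op f x = 0.
Proof.
move=> xO; apply/colP => i; rewrite !mxE -[RHS]oppr0; congr (- _).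
rewrite (_ : (fun y => _) = cst 0) ?Rintegral_cst ?mul0r//.
by apply/funext => y; rewrite a_out ?mul0r// => -[].
Qed.

(** A skew matrix maps every vector to an orthogonal one, so a rigid motion has
    no strain. *)
Lemma singular_op_rigid f (Q : 'M[R]_d) (c : V) x : Q^T = - Q ->
  (forall y, Omega y -> f y = Q *m y + c) -> singular_op f x = 0.
Proof.
move=> Qskew fQ.
have [xO|xO] := pselect (Omega x); last exact: singular_op_out.
apply/colP => i; rewrite !mxE -[RHS]oppr0; congr (- _).
rewrite (_ : (fun y => _) = cst 0) ?Rintegral_cst ?mul0r//.
apply/funext => y.
have [yO|yO] := pselect (Omega y); last by rewrite a_out ?mul0r// => -[].
rewrite fQ// fQ//; suff -> : dotp (Q *m y + c - (Q *m x + c)) (direction y x) = 0.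
  by rewrite mulr0 mul0r.
have -> : Q *m y + c - (Q *m x + c) = Q *m (y - x).
  by rewrite opprD addrACA subrr addr0 mulmxBr.
rewrite dotpC /direction dotpZl dotpC.
have dotpE (u v : V) : dotp u v = (u^T *m v) 0 0.
  by rewrite mxE; apply: eq_bigr => j _; rewrite mxE.
suff : dotp (Q *m (y - x)) (y - x) = - dotp (Q *m (y - x)) (y - x).
  by move=> /eqP; rewrite -addr_eq0 -mulr2n mulrn_eq0/= => /eqP ->; rewrite mulr0.
rewrite {1}dotpE trmx_mul Qskew mulmxN mulNmx -mulmxA mxE; congr (- _).
by rewrite dotpC dotpE.
Qed.

End singular_kernel.
(** * Functionals vanishing on a common kernel *)

(** By induction on the list: on the kernel of its first functional the other
    ones suffice, and an element off this kernel fixes the first coefficient. *)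
Lemma functional_span (K : fieldType) (U : lmodType K) (T : eqType) (s : seq T)
    (L : T -> U -> K) (X : set U) (F : U -> K) : uniq s ->
  (forall a u v, X u -> X v -> X (a *: u + v)) ->
  (forall t a u v, X u -> X v -> L t (a *: u + v) = a * L t u + L t v) ->
  (forall a u v, X u -> X v -> F (a *: u + v) = a * F u + F v) ->
  (forall u, X u -> (forall t, t \in s -> L t u = 0) -> F u = 0) ->
  exists c : T -> K, forall u, X u -> F u = \sum_(t <- s) c t * L t u.
Proof.
elim: s X F => [|t0 s IH] X F.
  move=> _ _ _ _ F0; exists (fun=> 0) => u Xu; rewrite big_nil F0//.
move=> /= /andP[t0s us] Xlin Llin Flin F0.
pose X' := [set u | X u /\ L t0 u = 0].
have [c Fc] : exists c : T -> K, forall u, X' u -> F u = \sum_(t <- s) c t * L t u.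
  apply: IH => // [a u v [Xu Lu] [Xv Lv]|t a u v [Xu _] [Xv _]|
      a u v [Xu _] [Xv _]|u [Xu Lu] Lsu].
  - by split; [exact: Xlin|rewrite Llin// Lu Lv mulr0 addr0].
  - exact: Llin.
  - exact: Flin.
  - by apply: F0 => // t; rewrite inE => /orP[/eqP ->|/Lsu].
have [[u1 [Xu1 Lu1]]|noL] := pselect (exists u, X u /\ L t0 u <> 0); last first.
  exists (fun t => if t == t0 then 0 else c t) => u Xu.
  rewrite big_cons eqxx mul0r add0r Fc//.
    apply: eq_big_seq => t ts; case: eqP => // tt0.
    by move: t0s; rewrite -tt0 ts.
  by split=> //; apply: contrapT => Lu; apply: noL; exists u.
pose k := F u1 - \sum_(t <- s) c t * L t u1.
exists (fun t => if t == t0 then k / L t0 u1 else c t) => u Xu.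
have Xw : X' (- (L t0 u / L t0 u1) *: u1 + u).
  by split; [exact: Xlin|rewrite Llin// mulNr divfK ?addNr//; exact/eqP].
have FE := Fc _ Xw; rewrite Flin// in FE.
have -> : F u = L t0 u / L t0 u1 * F u1 +
    \sum_(t <- s) c t * L t (- (L t0 u / L t0 u1) *: u1 + u).
  by rewrite -FE; ring.
rewrite big_cons eqxx.
under [X in _ + X = _]eq_bigr do rewrite Llin// mulrDr mulrCA.
rewrite big_split/= -mulr_sumr.
have -> : \sum_(t <- s) (if t == t0 then k / L t0 u1 else c t) * L t u =
    \sum_(t <- s) c t * L t u.
  apply: eq_big_seq => t ts; case: eqP => // tt0.
  by move: t0s; rewrite -tt0 ts.
by rewrite /k; field; exact/eqP.
Qed.

(** * Disjoint sets of rapidly decreasing positive measure *)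

Section positive_sets.
Context {disp : measure_display} {T : measurableType disp} {R : realType}.
Variable nu : {measure set T -> \bar R}.
Local Open Scope ereal_scope.

Lemma positive_measure_cover (I : countType) (E : set T) (F : I -> set T) :
  measurable E -> 0 < nu E -> (forall i, measurable (F i)) ->
  (forall x, E x -> exists i, F i x) -> exists i, 0 < nu (E `&` F i).
Proof.
move=> mE E0 mF EF; apply: contrapT => /forallNP noF.
pose G n := if unpickle n is Some i then E `&` F i else set0.
have G0 n : nu.-negligible (G n).
  rewrite /G; case: unpickle => [i|]; last exact: negligible_set0.
  apply/negligibleP; first exact: measurableI.
  by apply/eqP; rewrite -measure_le0 leNgt; apply/negP; exact: noF.
have : nu.-negligible E.
  apply: negligibleS (negligible_bigcup G0) => x Ex.
  have [i Fix] := EF x Ex; exists (pickle i) => //.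
  by rewrite /G pickleK.
by move=> /(negligibleP nu mE) E00; move: E0; rewrite E00 ltxx.
Qed.

Hypothesis small_subset : forall (E : set T) (eta : R), measurable E ->
  0 < nu E -> (0 < eta)%R ->
  exists F, [/\ measurable F, F `<=` E, 0 < nu F & nu F <= eta%:E].

(** Choose subsets D n one inside the other, each of measure at most c times the
    previous one. The differences of consecutive ones are disjoint and, as c is
    less than 1, of positive measure. *)
Lemma disjoint_positive_subsets (E : set T) (c : R) : measurable E ->
  0 < nu E -> nu E < +oo -> (0 < c < 1)%R ->
  exists B : nat -> set T, [/\ trivIset setT B,
    forall n, measurable (B n) /\ B n `<=` E &
    forall n, 0 < nu (B n) <= (c ^+ n)%:E * nu E].
Proof.
move=> mE E0 Eoo /andP[c0 c1].
pose good (D : set T) := [/\ measurable D, 0 < nu D & nu D < +oo].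
have step (D : set T) : exists F, good D ->
    [/\ good F, F `<=` D & nu F <= c%:E * nu D].
  have [[mD D0 Doo]|nD] := pselect (good D); last by exists set0.
  have Dfin : nu D \is a fin_num by rewrite ge0_fin_numE.
  have cD : (0 < c * fine (nu D))%R by rewrite mulr_gt0// fine_gt0// D0.
  have [F [mF FD F0 Fle]] := small_subset mD D0 cD.
  exists F => _; rewrite EFinM fineK// in Fle; split=> //.
  by split=> //; apply: le_lt_trans Doo; apply: le_measure; rewrite ?inE.
have [next nextP] := choice step.
pose D n := iter n next E.
have gD n : good (D n) by elim: n => [//|n /nextP[]].
have DS n : D n.+1 `<=` D n by have [] := nextP _ (gD n).
have Dle i j : (i <= j)%N -> D j `<=` D i.
  elim: j => [|j IH]; first by rewrite leqn0 => /eqP ->.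
  rewrite leq_eqVlt ltnS => /orP[/eqP ->//|/IH ji].
  exact: subset_trans (DS j) ji.
have Dc n : nu (D n) <= (c ^+ n)%:E * nu E.
  elim: n => [|n IH]; first by rewrite expr0 mul1e.
  have [_ _ /le_trans] := nextP _ (gD n); apply.
  by rewrite exprS EFinM -muleA lee_wpmul2l// lee_fin ltW.
exists (fun n => D n `\` D n.+1); split.
- apply/trivIsetP => i j _ _; wlog ij : i j / (i < j)%N.
    move=> hw; rewrite neq_lt => /orP[] ij; first by apply: hw => //; rewrite lt_eqF.
    by rewrite setIC; apply: hw => //; rewrite lt_eqF.
  move=> _; rewrite -subset0 => x [[_ nDi] [Djx _]]; apply: nDi.
  exact: Dle Djx.
- move=> n; have [mDn _ _] := gD n; have [mDn1 _ _] := gD n.+1; split.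
    exact: measurableD.
  by apply: subset_trans (Dle 0%N n _) => // x [].
- move=> n; have [mDn Dn0 Dnoo] := gD n; have [mDn1 Dn10 Dn1oo] := gD n.+1.
  have [_ _ Dn1c] := nextP _ (gD n).
  apply/andP; split; last first.
    apply: le_trans (Dc n); apply: le_measure; rewrite ?inE//.
    exact: measurableD.
  rewrite measureD// setIidr; last exact: DS.
  rewrite sube_gt0; apply: le_lt_trans Dn1c _.
  have Dfin : nu (D n) \is a fin_num by rewrite ge0_fin_numE.
  by rewrite -[ltRHS]mul1e lte_pmul2r// ?lte_fin.
Qed.

End positive_sets.

Lemma rational_approximation (R : realType) (d : nat) (v : 'cV[R]_d) (r : R) :
  0 < r -> exists q : 'cV[rat]_d, forall i, `|v i 0 - ratr (q i 0)| <= r.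
Proof.
move=> r0.
have ex i : exists q : rat, `|v i 0 - ratr q| <= r.
  have /rat_in_itvoo[q] : v i 0 - r < v i 0 by rewrite ltrBlDr ltrDl.
  rewrite in_itv/= => /andP[vq qv]; exists q.
  by rewrite ler_norml; apply/andP; split; lra.
have [f fP] := choice ex.
by exists (\col_i f i) => i; rewrite mxE.
Qed.

(** Cubes of a fixed small size centred at the rational points cover the space,
    so one of them meets E in positive measure. *)
Lemma lebesgue_small_subset (R : realType) (d : nat) (E : set 'cV[R]_d) (eta : R) :
  (0 < d)%N -> measurable E -> (0 < lebesgue_cV R d E)%E -> 0 < eta ->
  exists F, [/\ measurable F, F `<=` E, (0 < lebesgue_cV R d F)%E &
    (lebesgue_cV R d F <= eta%:E)%E].
Proof.
move=> d0 mE E0 eta0.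
pose r := Num.min 1 eta / 2.
have m0 : 0 < Num.min 1 eta by rewrite lt_min ltr01.
have r0 : 0 < r by rewrite divr_gt0.
pose box (q : 'cV[rat]_d) : set 'cV[R]_d :=
  cV_box (map_mx ratr q - const_mx r) (map_mx ratr q + const_mx r).
have [||q Eq] := @positive_measure_cover _ _ _ (lebesgue_cV R d) _ E box mE E0.
- by move=> q; exact: measurable_cV_box.
- move=> x _; have [q qx] := rational_approximation x r0; exists q => i.
  by rewrite !mxE; have := qx i; rewrite ler_distl.
exists (E `&` box q); split=> //.
  by apply: measurableI => //; exact: measurable_cV_box.
apply: (@le_trans _ _ (lebesgue_cV R d (box q))).
  apply: le_measure; rewrite ?inE//; last exact: measurable_cV_box.
  by apply: measurableI => //; exact: measurable_cV_box.
rewrite lebesgue_cV_box => [|i]; last by rewrite !mxE lerD2l ge0_cp// ltW.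
rewrite lee_fin (eq_bigr (fun=> Num.min 1 eta)); last first.
  by move=> i _; rewrite !mxE /r; field.
rewrite prodr_const card_ord (@le_trans _ _ (Num.min 1 eta ^+ 1))//.
  by rewrite ler_wiXn2l// ?ge_min ?lexx// ltW.
by rewrite expr1 ge_min lexx orbT.
Qed.
(** * Unbounded fields that a degenerate matrix field keeps bounded *)

Lemma norm1_mulmx_le (R : realType) (d : nat) (A : 'M[R]_d) (b : 'cV[R]_d) (M : R) :
  (forall i j, `|A i j| <= M) -> norm1 (A *m b) <= d%:R * M * norm1 b.
Proof.
move=> AM; rewrite -[d in d%:R]card_ord -sum1_card natr_sum 2!mulr_suml.
apply: ler_sum => i _; rewrite mul1r mxE (le_trans (ler_norm_sum _ _ _))//.
by rewrite mulr_sumr; apply: ler_sum => j _; rewrite normrM ler_wpM2r.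
Qed.

Section glue.
Context {R : realType} (d : nat).
Local Notation V := 'cV[R]_d.
Variables (F : nat -> set V) (w : nat -> V).
Hypotheses (mF : forall n, measurable (F n)) (tF : trivIset setT F).

(** The index is chosen classically; as the F n are disjoint, it is the only
    one. *)
Definition glue (x : V) : V :=
  if pselect (exists n, F n x) is left ex then w (projT1 (cid ex)) else 0.

Lemma glueE n x : F n x -> glue x = w n.
Proof.
move=> Fnx; rewrite /glue; case: pselect => [ex|]; last by case; exists n.
case: cid => m Fmx /=; congr w.
by apply: tF => //; exists x.
Qed.

Lemma glue_out x : (forall n, ~ F n x) -> glue x = 0.
Proof.
by rewrite /glue => nF; case: pselect => // -[n Fnx]; have := nF n.
Qed.

Lemma measurable_glue : measurable_fun [set: V] glue.
Proof.
move=> _ Y mY; rewrite setTI.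
pose G n := if `[< Y (w n) >] then F n else set0.
pose H := if `[< Y 0 >] then ~` \bigcup_n F n else set0.
rewrite (_ : glue @^-1` Y = (\bigcup_n G n) `|` H).
  apply: measurableU; last first.
    rewrite /H; case: ifP => // _; apply: measurableC.
    exact: bigcupT_measurable.
  by apply: bigcupT_measurable => n; rewrite /G; case: ifP.
apply/seteqP; split=> x /=.
  have [[n Fnx]|nF] := pselect (exists n, F n x).
    by rewrite (glueE Fnx) => Yw; left; exists n => //; rewrite /G asboolT.
  have nF' n : ~ F n x by move=> Fnx; apply: nF; exists n.
  rewrite glue_out// => Y0; right; rewrite /H asboolT// => -[n _ Fnx].
  exact: nF' Fnx.
move=> [[n _]|].
  by rewrite /G; case: asboolP => // Yw Fnx; rewrite (glueE Fnx).
rewrite /H; case: asboolP => // Y0 nF; rewrite glue_out// => n Fnx.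
by apply: nF; exists n.
Qed.

End glue.

Section degenerate_field.
Context {R : realType} (d : nat).
Local Notation V := 'cV[R]_d.
Local Notation mu := (lebesgue_cV R d).
Variables (A : V -> 'M[R]_d) (M : R) (E : set V).
Hypotheses (d0 : (0 < d)%N) (mA : forall i j, measurable_fun [set: V] (fun x => A x i j)).
Hypothesis AM : forall x i j, `|A x i j| <= M.
Hypotheses (mE : measurable E) (E0 : (0 < mu E)%E) (Eoo : (mu E < +oo)%E).
Hypothesis AE : forall x, E x -> exists v : V, v != 0 /\ A x *m v = 0.

Let M0 : 0 <= M.
Proof. exact: le_trans (normr_ge0 _) (AM 0 (Ordinal d0) (Ordinal d0)). Qed.

Let Q (q : 'cV[rat]_d) : V := map_mx ratr q.

(** Rational vectors stand for the null vectors of A: being countably many, one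
    of them is almost null on a set of positive measure, which replaces a
    measurable choice of null vectors. *)
Let G n (q : 'cV[rat]_d) : set V :=
  if 1 <= norm1 (Q q) <= 3 then
    [set x | norm1 (A x *m Q q) <= 2^-1 ^+ n] else set0.

Let mG n q : measurable (G n q).
Proof.
rewrite /G; case: ifP => // _.
have m : measurable_fun [set: V] (fun x => norm1 (A x *m Q q)).
  apply: measurable_norm1; apply/measurable_fun_coorP => i.
  under eq_fun do rewrite mxE.
  by apply: measurable_sum => j; apply: measurable_funM.
rewrite (_ : [set x | _] = (fun x => norm1 (A x *m Q q)) @^-1` `]-oo, 2^-1 ^+ n]%classic).
  by rewrite -[X in measurable X]setTI; exact: m.
by apply/seteqP; split=> x /=; rewrite in_itv.
Qed.

Let coverG n x : E x -> exists q, G n q x.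
Proof.
move=> /AE[v [v0 Av]].
have nv : 0 < norm1 v.
  rewrite lt_neqAle norm1_ge0 andbT eq_sym; apply: contra v0 => /eqP v0.
  by rewrite -enorm_eq0 eq_le enorm_ge0 andbT -v0 enorm_le_norm1.
(* Norm 2 leaves room for a rational vector of norm between 1 and 3. *)
pose v' := (2 / norm1 v) *: v.
have nv' : norm1 v' = 2.
  by rewrite norm1Z ger0_norm ?divr_ge0 ?norm1_ge0// divfK// gt_eqF.
have Av' : A x *m v' = 0 by rewrite -scalemxAr Av scaler0.
(* A radius of 2 ^- n / D makes both norm1 (v' - q) <= 1 and
   norm1 (A x *m (v' - q)) <= 2 ^- n. *)
pose D : R := 1 + d%:R + d%:R * M * d%:R.
have dMd : 0 <= d%:R * M * d%:R by rewrite !mulr_ge0.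
have D0 : 0 < D by rewrite /D; have := ler0n R d; lra.
have n0 : 0 < 2^-1 ^+ n :> R by rewrite exprn_gt0.
have r0 : 0 < 2^-1 ^+ n / D by rewrite divr_gt0.
have [q qv] := rational_approximation v' r0.
have dq : norm1 (v' - Q q) <= d%:R * (2^-1 ^+ n / D).
  rewrite -[d in d%:R]card_ord -sum1_card natr_sum mulr_suml.
  by apply: ler_sum => i _; rewrite !mxE mul1r; have := qv i; rewrite !mxE.
have dD : d%:R <= D by rewrite /D; lra.
have dq1 : norm1 (v' - Q q) <= 1.
  have n1 : 2^-1 ^+ n <= 1 :> R by rewrite exprn_ile1// invf_le1// ler1n.
  have dD1 : d%:R / D <= 1 by rewrite ler_pdivrMr// mul1r.
  by rewrite (le_trans dq)// mulrCA mulr_ile1// ?divr_ge0// ltW.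
exists q; rewrite /G ifT.
  rewrite /= (_ : Q q = v' - (v' - Q q)); last by rewrite subKr.
  rewrite mulmxBr Av' sub0r norm1N (le_trans (norm1_mulmx_le _ (AM x)))//.
  rewrite (le_trans (ler_wpM2l _ dq)) ?mulr_ge0//.
  have -> : d%:R * M * (d%:R * (2^-1 ^+ n / D)) = 2^-1 ^+ n * (d%:R * M * d%:R / D) by ring.
  rewrite ler_piMr ?(ltW n0)// ler_pdivrMr// mul1r /D lerDr.
  by rewrite addr_ge0.
apply/andP; split.
  have := norm1D (v' - Q q) (Q q); rewrite subrK nv'; lra.
have := norm1B v' (v' - Q q); rewrite subKr nv'; lra.
Qed.

(** Take the value 2 ^ n q, with q a nearly null vector, on disjoint sets of
    measure at most mu E / 128 ^ n: the sixth power is integrable as 2 ^ 6 < 128,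
    and A q <= 2 ^ -n compensates for the factor 2 ^ n. *)
Lemma exists_unbounded_field : exists W : V -> V,
  [/\ measurable_fun [set: V] W, (forall x, ~ E x -> W x = 0),
      (\int[mu]_x (norm1 (W x) ^+ 6)%:E < +oo)%E,
      (forall x, norm1 (A x *m W x) <= 1) &
      forall K : R, exists F : set V,
        [/\ measurable F, F `<=` E, (0 < mu F)%E & forall x, F x -> K <= norm1 (W x)]].
Proof.
have [|B [tB BE Bmu]] := disjoint_positive_subsets
  (nu := mu) (fun E0 eta => lebesgue_small_subset (eta := eta) d0) (c := 128^-1) mE E0 Eoo.
  by rewrite invr_gt0 ltr0n/= invf_lt1// ltr1n.
have ex n : exists q, (0 < mu (B n `&` G n q))%E.
  have [mB BnE] := BE n; have /andP[B0 _] := Bmu n.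
  by apply: positive_measure_cover => // x /BnE; exact: coverG.
have [q qP] := choice ex.
pose F n := B n `&` G n (q n).
have mF n : measurable (F n) by apply: measurableI => //; have [] := BE n.
have tF : trivIset setT F.
  by apply: trivIset_setIr; exact: tB.
have Qq n : 1 <= norm1 (Q (q n)) <= 3.
  by have := qP n; rewrite /G; case: ifP => //; rewrite setI0 measure0 ltxx.
have FG n x : F n x -> norm1 (A x *m Q (q n)) <= 2^-1 ^+ n.
  by move=> [_]; rewrite /G Qq.
pose w n := 2 ^+ n *: Q (q n).
have nw n : 2 ^+ n <= norm1 (w n) <= 2 ^+ n * 3.
  have /andP[q1 q3] := Qq n.
  rewrite /w norm1Z ger0_norm ?exprn_ge0//.
  by rewrite ler_pM2l ?exprn_gt0// ler_peMr ?exprn_ge0.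
exists (glue F w); split.
- exact: measurable_glue.
- move=> x nE; apply: glue_out => n [Bnx _]; apply: nE.
  by have [_] := BE n; exact.
- pose s n x : \bar R := ((norm1 (w n) ^+ 6)%:E * (\1_(F n) x)%:E)%E.
  have s0 n x : (0 <= s n x)%E.
    by rewrite mule_ge0// lee_fin ?exprn_ge0 ?norm1_ge0// indicE.
  have ms n : measurable_fun [set: V] (s n).
    apply: emeasurable_funM => //; apply/measurable_EFinP.
    exact: measurable_indic.
  apply: (@le_lt_trans _ _ (\int[mu]_x (\sum_(0 <= n <oo) s n x))%E).
    apply: ge0_le_integral => //.
    + by move=> x _; rewrite lee_fin exprn_ge0 ?norm1_ge0.
    + apply/measurable_EFinP; apply: measurable_funX; apply: measurable_norm1.
      exact: measurable_glue.
    + exact: ge0_emeasurable_sum.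
    + move=> x _; have [[n Fnx]|nF] := pselect (exists n, F n x).
        rewrite (glueE _ tF Fnx) (le_trans _ (nneseries_ge n (s0^~ x)))//.
        by rewrite /s indicE mem_set// mule1.
      rewrite glue_out; last by move=> n Fnx; apply: nF; exists n.
      by rewrite norm1_0 expr0n/=; apply: nneseries_ge0.
  rewrite integral_nneseries//.
  (* 729 is 3 ^ 6, from norm1 q <= 3. *)
  apply: (@le_lt_trans _ _ (729 * 2 * fine (mu E))%:E); last exact: ltry.
  have Efin : mu E \is a fin_num by rewrite ge0_fin_numE.
  apply: nneseries_le => [n|N]; first by apply: integral_ge0 => x _.
  apply: (@le_trans _ _ (\sum_(0 <= n < N) (729 * fine (mu E) * 2^-1 ^+ n)%:E)%E).
    apply: lee_sum => n _; rewrite /s ge0_integralZl_EFin//; last 2 first.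
    + by apply/measurable_EFinP; exact: measurable_indic.
    + by rewrite exprn_ge0 ?norm1_ge0.
    rewrite integral_indic// setIT.
    have muF : (mu (F n) <= (128^-1 ^+ n)%:E * mu E)%E.
      have /andP[_] := Bmu n; apply: le_trans.
      by apply: le_measure; rewrite ?inE//; [exact: (BE n).1|move=> x []].
    apply: (@le_trans _ _ (((2 ^+ n * 3) ^+ 6)%:E * ((128^-1 ^+ n)%:E * mu E))%E).
      apply: lee_pmul => //; first by rewrite lee_fin exprn_ge0 ?norm1_ge0.
      by rewrite lee_fin lerXn2r ?nnegrE ?mulr_ge0 ?exprn_ge0 ?norm1_ge0//; case/andP: (nw n).
    rewrite -(fineK Efin) -!EFinM lee_fin.
    have -> : (2 ^+ n * 3) ^+ 6 = 729 * 64 ^+ n :> R.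
      rewrite exprMn -exprM mulnC exprM mulrC.
      by congr (_ * _ ^+ n); ring.
    have -> : 2^-1 = 64 * 128^-1 :> R by field.
    by rewrite exprMn le_eqVlt; apply/orP; left; apply/eqP; ring.
  rewrite sumEFin lee_fin -mulr_sumr.
  have m0 : 0 <= fine (mu E) by rewrite fine_ge0.
  suff -> : \sum_(0 <= n < N) 2^-1 ^+ n = 2 - 2 * 2^-1 ^+ N :> R.
    have t0 : 0 <= 2^-1 ^+ N :> R by rewrite exprn_ge0.
    by have := mulr_ge0 m0 t0; lra.
  elim: N => [|N IH]; first by rewrite big_nil expr0; ring.
  by rewrite big_nat_recr//= IH exprS; field.
- move=> x; have [[n Fnx]|nF] := pselect (exists n, F n x).
    rewrite (glueE _ tF Fnx) -scalemxAr norm1Z ger0_norm ?exprn_ge0//.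
    rewrite (le_trans (ler_wpM2l _ (FG n x Fnx))) ?exprn_ge0//.
    by rewrite -exprMn divff ?expr1n// pnatr_eq0.
  rewrite glue_out; last by move=> n Fnx; apply: nF; exists n.
  by rewrite mulmx0 norm1_0 ler01.
- move=> K; pose n := Num.truncn `|K|; exists (F n.+1); split=> //.
  + by move=> x [Bx _]; have [_] := BE n.+1; exact.
  + exact: qP.
  + move=> x Fx; rewrite (glueE _ tF Fx).
    have /andP[+ _] := nw n.+1; apply: le_trans.
    rewrite (le_trans (ler_norm _))// (le_trans (ltW (truncnS_gt _)))//.
    by rewrite -natrX ler_nat ltnW// ltn_expl.
Qed.

End degenerate_field.
(** * Bounded fields on a bounded domain and the annihilator of the affine maps *)

Section bounded_domain.
Context {R : realType} (d : nat).
Local Notation V := 'cV[R]_d.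
Local Notation mu := (lebesgue_cV R d).
Variable Omega : set V.
Implicit Types (u v w f h psi : V -> V).

Definition cutoff w x : V := if x \in Omega then w x else 0.

Lemma cutoffE w x : Omega x -> cutoff w x = w x.
Proof. by move=> xO; rewrite /cutoff mem_set. Qed.

Lemma cutoff_out w x : ~ Omega x -> cutoff w x = 0.
Proof. by move=> xO; rewrite /cutoff memNset. Qed.

Lemma cutoff_id w : (forall x, ~ Omega x -> w x = 0) -> cutoff w = w.
Proof.
move=> wO; apply/funext => x; rewrite /cutoff.
by case: ifPn => // /negP xO; rewrite wO// => /mem_set.
Qed.

Hypotheses (mOmega : measurable Omega) (finOmega : (mu Omega < +oo)%E).

Lemma measurable_cutoff w : measurable_fun Omega w -> measurable_fun [set: V] (cutoff w).
Proof.
move=> mw; apply/measurable_fun_coorP => i.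
rewrite (_ : (fun x => _) = (fun x => w x i 0) \_ Omega).
  apply/(measurable_restrictT _ mOmega).
  exact: measurableT_comp (measurable_coor i) mw.
by apply/funext => x; rewrite /cutoff patchE; case: ifP => //; rewrite mxE.
Qed.

Lemma Linfty_bounded w : Linfty Omega w ->
  exists M, 0 <= M /\ \forall x \ae mu, Omega x -> norm1 (w x) <= M.
Proof.
move=> [_]; rewrite /Linfty_norm.
have := ess_sup_ge mu (fun x => (((@enorm R d \o w) \_ Omega) x)%:E).
case: ess_sup => [r||]//= ae_r _.
- exists (d%:R * `|r|); split; first by rewrite mulr_ge0.
  apply: filterS ae_r => x + xO; rewrite patchE mem_set// lee_fin => wr.
  rewrite (le_trans (norm1_le_enorm _))// ler_wpM2l// (le_trans wr)//.
  exact: ler_norm.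
- by exists 0; split => //; apply: filterS ae_r => x; rewrite leeNy_eq.
Qed.

Lemma bounded_Linfty w M : measurable_fun Omega w ->
  (forall x, Omega x -> norm1 (w x) <= M) -> Linfty Omega w.
Proof.
move=> mw wM; split=> //; apply: (@le_lt_trans _ _ (`|M|%:E)); last exact: ltry.
apply/ess_supP; apply: nearW => x; rewrite lee_fin patchE.
case: ifP => [xO|_]; last exact: normr_ge0.
apply: le_trans (enorm_le_norm1 _) _.
by rewrite (le_trans (wM _ (set_mem xO)))// ler_norm.
Qed.

Lemma L6_bounded f M : measurable_fun [set: V] f ->
  (forall x, ~ Omega x -> f x = 0) ->
  (\forall x \ae mu, Omega x -> norm1 (f x) <= M) -> L6 f.
Proof.
move=> mf fO fM; split=> //.
have mi : measurable_fun [set: V] (\1_Omega : V -> R) by exact: measurable_indic.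
apply: (@le_lt_trans _ _ (\int[mu]_x ((M ^+ 6)%:E * (\1_Omega x)%:E))%E).
  apply: ae_ge0_le_integral => //.
  - by move=> x _; rewrite lee_fin exprn_ge0 ?norm1_ge0.
  - by apply/measurable_EFinP; exact: measurable_norm1_6.
  - move=> x _; rewrite mule_ge0// lee_fin ?exprn_even_ge0//.
  - by apply: emeasurable_funM => //; exact/measurable_EFinP.
  - apply: filterS fM => x fM _; rewrite indicE.
    have [xO|xO] := pselect (Omega x).
      rewrite mem_set// mule1 lee_fin lerXn2r ?nnegrE ?norm1_ge0 ?fM//.
      exact: le_trans (norm1_ge0 _) (fM xO).
    by rewrite fO// norm1_0 memNset// mule0 expr0n.
rewrite ge0_integralZl_EFin//; last 2 first.
- exact/measurable_EFinP.
- by rewrite exprn_even_ge0.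
rewrite integral_indic// setIT lte_mul_pinfty// ?lee_fin ?exprn_even_ge0//.
Qed.

Lemma L6_cutoff w : Linfty Omega w -> L6 (cutoff w).
Proof.
move=> wL; have [M [M0 wM]] := Linfty_bounded wL; case: wL => mw _.
apply: (L6_bounded (M := M)).
- exact: measurable_cutoff.
- exact: cutoff_out.
- by apply: filterS wM => x + xO; rewrite cutoffE//; exact.
Qed.

Lemma Rintegral_cutoff w f :
  \int[mu]_(x in Omega) dotp (w x) (f x) = \int[mu]_x dotp (w x) (cutoff f x).
Proof.
rewrite Rintegral_mkcond; apply: eq_Rintegral => x _.
by rewrite patchE /cutoff; case: ifP => // _; rewrite dotpC dotp0l.
Qed.

Lemma integrable_dotp f h : L6 f -> L6 h -> (forall x, ~ Omega x -> f x = 0) ->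
  mu.-integrable setT (fun x => (dotp (f x) (h x))%:E).
Proof.
move=> [mf foo] [mh hoo] fO.
have mi : measurable_fun [set: V] (\1_Omega : V -> R) by exact: measurable_indic.
apply: (@le_integrable_ereal _ _ _ mu (fun x => dotp (f x) (h x))
  (fun x => (\1_Omega x)%:E + ((norm1 (f x) ^+ 6)%:E + (norm1 (h x) ^+ 6)%:E))%E).
- exact: measurable_dotp.
- apply: emeasurable_funD; first exact/measurable_EFinP.
  by apply: emeasurable_funD; apply/measurable_EFinP; exact: measurable_norm1_6.
- move=> x; rewrite -!EFinD lee_fin indicE.
  have [s0 t0] := (norm1_ge0 (f x), norm1_ge0 (h x)).
  have [xO|xO] := pselect (Omega x); last first.
    by rewrite memNset// fO// dotp0l normr0 !addr_ge0 ?exprn_ge0 ?norm1_ge0.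
  rewrite mem_set// (le_trans (dotp_le _ (coord_le_norm1 _)))//=.
  move: (norm1 (f x)) (norm1 (h x)) s0 t0 => s t s0 t0.
  have p3 : s * t <= 1 + (s * t) ^+ 3.
    have p0 := mulr_ge0 s0 t0; rewrite -subr_ge0.
    move: (s * t) p0 => p p0; have [p1|/ltW p1] := leP p 1.
      by have := exprn_ge0 3 p0; lra.
    by rewrite exprS; have := exprn_ege1 2 p1; nra.
  by rewrite (le_trans p3)// lerD2l mul_cube_le_sixth.
- rewrite ge0_integralD//; last 3 first.
  + exact/measurable_EFinP.
  + by move=> x _; rewrite -EFinD lee_fin addr_ge0 ?exprn_ge0 ?norm1_ge0.
  + by apply: emeasurable_funD; apply/measurable_EFinP; exact: measurable_norm1_6.
  rewrite ge0_integralD//; last 4 first.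
  + by move=> x _; rewrite lee_fin exprn_ge0 ?norm1_ge0.
  + by apply/measurable_EFinP; exact: measurable_norm1_6.
  + by move=> x _; rewrite lee_fin exprn_ge0 ?norm1_ge0.
  + by apply/measurable_EFinP; exact: measurable_norm1_6.
  rewrite integral_indic// setIT.
  by apply: lte_add_pinfty => //; exact: lte_add_pinfty.
Qed.

(** A finite family whose combinations include the rigid motions. *)
Definition affine_field (t : 'I_d + 'I_d * 'I_d) (x : V) : V :=
  match t with
  | inl i => delta_mx i 0
  | inr (i, j) => x j 0 *: delta_mx i 0
  end.

Lemma affine_fieldE (Q : 'M[R]_d) (c x : V) : Q *m x + c = \sum_t
  match t with inl i => c i 0 | inr (i, j) => Q i j end *: affine_field t x.
Proof.
rewrite big_sumType/= addrC; congr (_ + _); last first.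
  rewrite [LHS]matrix_sum_delta; apply: eq_bigr => i _.
  by rewrite big_ord_recl big_ord0 addr0.
transitivity (\sum_(p : 'I_d * 'I_d)
    Q p.1 p.2 *: (x p.2 0 *: (delta_mx p.1 0 : V))); last first.
  by apply: eq_bigr => -[].
rewrite -(pair_bigA _ (fun i j => Q i j *: (x j 0 *: (delta_mx i 0 : V))))/=.
apply/colP => k; rewrite mxE summxE [RHS](bigD1 k)//= [X in _ + X]big1 => [|i ik].
  by rewrite addr0 summxE; apply: eq_bigr => j _; rewrite !mxE !eqxx mulr1.
by rewrite summxE big1// => j _; rewrite !mxE eq_sym (negbTE ik)/= !mulr0.
Qed.

Lemma norm1_delta i : norm1 (delta_mx i 0 : V) <= d%:R.
Proof.
rewrite -[d in d%:R]card_ord -sum1_card natr_sum.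
apply: ler_sum => k _; rewrite mxE eqxx andbT.
by case: (k == i); rewrite /= ?normr1 ?normr0 ?ler01.
Qed.

Variables (N : R) (Omega_le : forall x i, Omega x -> `|x i 0| <= N).

Lemma measurable_affine_field t : measurable_fun [set: V] (affine_field t).
Proof.
case: t => [i|[i j]] /=; first exact: measurable_cst.
by apply: measurable_cVZ; [exact: measurable_coor|exact: measurable_cst].
Qed.

Lemma affine_field_le t x : Omega x ->
  norm1 (affine_field t x) <= d%:R + `|N| * d%:R.
Proof.
move=> xO; case: t => [i|[i j]] /=.
  by rewrite (le_trans (norm1_delta i))// lerDl mulr_ge0.
rewrite norm1Z ler_wpDl// ler_pM ?norm1_ge0 ?norm1_delta//.
by rewrite (le_trans (Omega_le j xO))// ler_norm.
Qed.

Lemma Linfty_affine (c : 'I_d + 'I_d * 'I_d -> R) :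
  Linfty Omega (fun x => \sum_t c t *: affine_field t x).
Proof.
apply: (bounded_Linfty (M := \sum_t `|c t| * (d%:R + `|N| * d%:R))).
  apply: measurable_funTS; apply/measurable_fun_coorP => i.
  under eq_fun do rewrite summxE.
  apply: measurable_sum => t; under eq_fun do rewrite mxE.
  by apply: measurable_funM => //; exact: measurable_coord (measurable_affine_field t).
move=> x xO; have norm1_sum (s : seq ('I_d + 'I_d * 'I_d)) (w : _ -> V) :
    norm1 (\sum_(t <- s) w t) <= \sum_(t <- s) norm1 (w t).
  elim: s => [|t s IH]; first by rewrite !big_nil norm1_0.
  by rewrite !big_cons (le_trans (norm1D _ _))// lerD2l.
rewrite (le_trans (norm1_sum _ _))//; apply: ler_sum => t _.
by rewrite norm1Z ler_wpM2l// affine_field_le.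
Qed.

Lemma Linfty_affine_field t : Linfty Omega (affine_field t).
Proof.
apply: (bounded_Linfty (M := d%:R + `|N| * d%:R)); last exact: affine_field_le.
exact: measurable_funTS (measurable_affine_field t).
Qed.

Definition test_field : set (V -> V) := [set psi |
  [/\ measurable_fun [set: V] psi, exists M, forall x, norm1 (psi x) <= M &
      forall x, ~ Omega x -> psi x = 0]].

Lemma test_field_linear (k : R) u v : test_field u -> test_field v ->
  test_field (k *: u + v).
Proof.
move=> [um [Mu uM] uO] [vm [Mv vM] vO]; split.
- apply/measurable_fun_coorP => i.
  rewrite (_ : (fun x => _) = (fun x => k * u x i 0 + v x i 0)); last first.
    by apply/funext => x; rewrite !fctE !mxE.
  apply: measurable_funD; last exact: measurable_coord.
  by apply: measurable_funM => //; exact: measurable_coord.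
- exists (`|k| * Mu + Mv) => x; rewrite !fctE (le_trans (norm1D _ _))//.
  by rewrite norm1Z lerD// ler_wpM2l.
- by move=> x xO; rewrite !fctE uO// vO// scaler0 addr0.
Qed.

Lemma test_field_L6 u : test_field u -> L6 u.
Proof.
by move=> [um [M uM] uO]; apply: (L6_bounded (M := M)) => //; exact: nearW.
Qed.

Lemma pairing_linear h (k : R) u v : L6 h -> test_field u -> test_field v ->
  \int[mu]_x dotp ((k *: u + v) x) (h x) =
  k * (\int[mu]_x dotp (u x) (h x)) + \int[mu]_x dotp (v x) (h x).
Proof.
move=> hL6 uX vX; have [[_ _ uO] [_ _ vO]] := (uX, vX).
have iu := integrable_dotp (test_field_L6 uX) hL6 uO.
have iv := integrable_dotp (test_field_L6 vX) hL6 vO.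
rewrite -RintegralZl// -RintegralD//.
  by apply: eq_Rintegral => x _; rewrite !fctE dotpDl dotpZl.
exact: (integrableZl measurableT k iu).
Qed.

Lemma pairing_affine (c : 'I_d + 'I_d * 'I_d -> R) psi : test_field psi ->
  \int[mu]_x dotp (psi x) (cutoff (fun x => \sum_t c t *: affine_field t x) x) =
  \sum_t c t * \int[mu]_x dotp (psi x) (cutoff (affine_field t) x).
Proof.
move=> psiX; have [_ _ psiO] := psiX.
have i t := integrable_dotp (test_field_L6 psiX)
  (L6_cutoff (Linfty_affine_field t)) psiO.
transitivity (\int[mu]_x \sum_t c t * dotp (psi x) (cutoff (affine_field t) x)).
  apply: eq_Rintegral => x _.
  have [xO|xO] := pselect (Omega x); last first.
    rewrite cutoff_out// dotpC dotp0l big1// => t _.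
    by rewrite cutoff_out// dotpC dotp0l mulr0.
  rewrite cutoffE// dotpC.
  have dotp_sum (I : Type) (s : seq I) (w : I -> V) (e : V) :
      dotp (\sum_(i <- s) w i) e = \sum_(i <- s) dotp (w i) e.
    elim: s => [|k s IH]; first by rewrite !big_nil dotp0l.
    by rewrite !big_cons dotpDl IH.
  rewrite dotp_sum; apply: eq_bigr => t _.
  by rewrite dotpZl cutoffE// dotpC.
rewrite Rintegral_sum; last first.
  by move=> t; exact: (integrableZl measurableT (c t) (i t)).
by apply: eq_bigr => t _; rewrite RintegralZl//; exact: i.
Qed.

Lemma test_field_Vspace psi : test_field psi ->
  (forall t, \int[mu]_x dotp (psi x) (cutoff (affine_field t) x) = 0) ->
  Vspace Omega psi.
Proof.
move=> psiX psi0; have [mpsi [M psiM] psiO] := psiX.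
split; first by apply: (bounded_Linfty (M := M)) => //; exact: measurable_funTS.
move=> _ [Q [c [_ ->]]]; rewrite Rintegral_cutoff.
under [X in cutoff X]eq_fun do rewrite affine_fieldE.
by rewrite pairing_affine// big1// => t _; rewrite psi0 mulr0.
Qed.

(** Test h against the sign of each of its coordinates. *)
Lemma pairing_separates h : L6 h -> (forall x, ~ Omega x -> h x = 0) ->
  (forall psi, test_field psi -> \int[mu]_x dotp (psi x) (h x) = 0) ->
  \forall x \ae mu, h x = 0.
Proof.
move=> hL6 hO h0; have [mh hoo] := hL6.
suff hi i : \forall x \ae mu, h x i 0 = 0.
  have : \forall x \ae mu, forall i : 'I_d, h x i 0 = 0.
    have Hn (n : nat) : \forall x \ae mu, forall i : 'I_d, i = n :> nat -> h x i 0 = 0.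
      have [nd|dn] := ltnP n d.
        apply: filterS (hi (Ordinal nd)) => x hx i iE.
        by rewrite -[RHS]hx; congr (h x _ 0); exact: val_inj.
      by apply: nearW => x i iE; move: (ltn_ord i); rewrite iE ltnNge dn.
    by move/ae_foralln : Hn; apply: filterS => x hx i; exact: (hx i).
  by apply: filterS => x hx; apply/colP => i; rewrite hx mxE.
pose psi x : V := Num.sg (h x i 0) *: delta_mx i 0.
have msg : measurable_fun [set: V] (fun x => Num.sg (h x i 0)).
  have mhi := measurable_coord i mh.
  rewrite (_ : (fun x => _) = (fun x => \1_([set x | 0 < h x i 0]) x -
      \1_([set x | h x i 0 < 0]) x)); last first.
    apply/funext => x; rewrite !indicE; case: sgrP => hx.
    - by rewrite !memNset ?subr0//= hx ltxx.
    - by rewrite mem_set// memNset ?subr0//=; apply/negP; rewrite -leNgt ltW.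
    - by rewrite memNset ?mem_set ?sub0r//=; apply/negP; rewrite -leNgt ltW.
  apply: measurable_funB; apply: measurable_indic.
  - rewrite (_ : [set x | _] = (fun x => h x i 0) @^-1` `]0, +oo[%classic).
      by rewrite -[X in measurable X]setTI; exact: mhi.
    by apply/seteqP; split=> x /=; rewrite in_itv/= andbT.
  - rewrite (_ : [set x | _] = (fun x => h x i 0) @^-1` `]-oo, 0[%classic).
      by rewrite -[X in measurable X]setTI; exact: mhi.
    by apply/seteqP; split=> x /=; rewrite in_itv.
have psiX : test_field psi.
  split.
  - by apply: measurable_cVZ => //; exact: measurable_cst.
  - exists d%:R => x; rewrite norm1Z (le_trans _ (norm1_delta i))//.
    by rewrite ler_piMl ?norm1_ge0// normr_sg; case: eqP.
  - by move=> x xO; rewrite /psi hO// mxE sgr0 scale0r.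
have dotpE x : dotp (psi x) (h x) = `|h x i 0|.
  rewrite dotpZl /dotp (bigD1 i)//= big1 ?addr0 => [|j ji].
    by rewrite !mxE !eqxx mul1r -normrEsg.
  by rewrite mxE (negbTE ji) mul0r.
have [_ _ psiO] := psiX.
have ih := integrable_dotp (test_field_L6 psiX) hL6 psiO.
have hi0 : (\int[mu]_x `|(h x i 0)%:E| = 0)%E.
  have hE : (\int[mu]_x `|(h x i 0)%:E| = \int[mu]_x (dotp (psi x) (h x))%:E)%E.
    by apply: eq_integral => x _; rewrite dotpE.
  apply/eqP; rewrite hE -fine_eq0; last exact: integrable_fin_num.
  by apply/eqP; exact: h0.
have mhi : measurable_fun [set: V] (fun x => (h x i 0)%:E).
  by apply/measurable_EFinP; exact: measurable_coord.
have /(_ hi0) := (ae_eq_integral_abs mu measurableT mhi).1.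
by apply: filterS => x /(_ I) /= [].
Qed.

(** Finitely many linear conditions, the vanishing of the pairings with the
    affine fields, suffice to put a test field in Vspace, so the functional of h
    on test fields is a combination of these pairings and h is affine on
    Omega. *)
Lemma Vspace_annihilator_bounded h : L6 h -> (forall x, ~ Omega x -> h x = 0) ->
  (forall psi, Vspace Omega psi -> \int[mu]_x dotp (cutoff psi x) (h x) = 0) ->
  exists M, \forall x \ae mu, norm1 (h x) <= M.
Proof.
move=> hL6 hO hV.
pose L t psi := \int[mu]_x dotp (psi x) (cutoff (affine_field t) x).
have [||||c hc] := functional_span (L := L) (X := test_field)
  (F := fun psi => \int[mu]_x dotp (psi x) (h x)) (index_enum_uniq _).
- exact: test_field_linear.
- move=> t k u v; apply: pairing_linear; exact: L6_cutoff (Linfty_affine_field t).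
- by move=> k u v; exact: pairing_linear.
- move=> psi psiX Lpsi; rewrite -[RHS](hV psi); last first.
    by apply: test_field_Vspace => // t; apply: Lpsi; rewrite mem_index_enum.
  apply: eq_Rintegral => x _; have [xO|xO] := pselect (Omega x).
    by rewrite cutoffE.
  by rewrite hO// dotpC dotp0l dotpC dotp0l.
pose p x : V := \sum_t c t *: affine_field t x.
have pL : Linfty Omega p by exact: Linfty_affine.
have h0 : \forall x \ae mu, h x - cutoff p x = 0.
  apply: pairing_separates.
  - by apply: L6B => //; exact: L6_cutoff.
  - by move=> x xO; rewrite hO// cutoff_out// subr0.
  move=> psi psiX; have [_ _ psiO] := psiX.
  under eq_Rintegral do rewrite dotpC dotpBl dotpC (dotpC (cutoff p _)).
  rewrite RintegralB//; last 2 first.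
  - exact: integrable_dotp (test_field_L6 psiX) hL6 psiO.
  - exact: integrable_dotp (test_field_L6 psiX) (L6_cutoff pL) psiO.
  by rewrite hc// pairing_affine// subrr.
have [M [M0 pM]] := Linfty_bounded pL.
exists M; apply: filterS2 h0 pM => x /eqP; rewrite subr_eq0 => /eqP -> pM.
have [xO|xO] := pselect (Omega x); first by rewrite cutoffE// pM.
by rewrite cutoff_out// norm1_0.
Qed.

End bounded_domain.
(** * The linearized operator as a singular operator *)

Section kernel.
Context {R : realType} (d : nat).
Local Notation V := 'cV[R]_d.
Local Notation mu := (lebesgue_cV R d).
Variables (Omega : set V) (J g : R -> R) (eps : R) (u0 : V -> V).
Hypothesis mOmega : measurable Omega.
Hypothesis u0_measurable : measurable_fun Omega u0.
Hypotheses (mJ : measurable_fun [set: R] J)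
  (mg2 : measurable_fun [set: R] (g^`(2)%classic)).
Variables (MJ Mg : R).
Hypotheses (J_le : forall r, `|J r| <= MJ)
  (g2_le : forall r, `|g^`(2)%classic r| <= Mg).

Let near_diagonal : set (V * V) := [set z | enorm (z.2 - z.1) < eps].

(** The kernel for which singular_op is the linearized operator at u0. The field
    u0 is cut off because it is measurable only on Omega. *)
Definition strain_kernel (x y : V) : R :=
  \1_Omega x * \1_Omega y * \1_near_diagonal (x, y) *
  (kernel_weight J g eps y x (cutoff Omega u0) / enorm (y - x)).

Definition strain_kernel_cst : R :=
  MJ * `|(eps ^+ d.+1 * unit_ball_volume d)^-1| * Mg.

Lemma strain_kernel_cst_ge0 : 0 <= strain_kernel_cst.
Proof.
by rewrite !mulr_ge0//; [exact: le_trans (J_le 0)|exact: le_trans (g2_le 0)].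
Qed.

Lemma strain_kernel_sym x y : strain_kernel x y = strain_kernel y x.
Proof.
rewrite /strain_kernel /kernel_weight strainC (enormB y x).
have -> : (\1_near_diagonal (x, y) : R) = \1_near_diagonal (y, x).
  rewrite !indicE; congr (nat_of_bool _)%:R.
  by apply/idP/idP; rewrite !inE /near_diagonal/= enormB.
by rewrite [\1_Omega x * _]mulrC.
Qed.

Lemma strain_kernel_le x y : `|strain_kernel x y| <=
  \1_Omega x * \1_Omega y * (strain_kernel_cst / enorm (y - x)).
Proof.
have i01 (T : Type) (A : set T) z : 0 <= (\1_A z : R) <= 1.
  by rewrite indicE; case: (_ \in _); rewrite /= ?lexx ?ler01.
have [/andP[ix0 _] /andP[iy0 _]] := (i01 _ Omega x, i01 _ Omega y).
have /andP[n0 n1] := i01 _ near_diagonal (x, y).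
rewrite /strain_kernel -mulrA normrM (ger0_norm (mulr_ge0 ix0 iy0)).
rewrite ler_wpM2l ?mulr_ge0// normrM (ger0_norm n0).
rewrite (le_trans (ler_piMl _ n1)) ?normr_ge0//.
rewrite normrM normfV (ger0_norm (enorm_ge0 _)) ler_wpM2r ?invr_ge0 ?enorm_ge0//.
by rewrite /kernel_weight !normrM ler_pM// ler_wpM2r.
Qed.

Lemma measurable_strain_kernel :
  measurable_fun [set: V * V] (fun z : V * V => strain_kernel z.1 z.2).
Proof.
have mcut0 := measurable_cutoff mOmega u0_measurable.
have mi : measurable_fun [set: V] (\1_Omega : V -> R) by exact: measurable_indic.
have md : measurable_fun [set: V * V] (fun z : V * V => z.2 - z.1).
  exact: measurable_cVB.
have me := measurable_enorm md.
have mie := measurable_inv_enorm md.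
have mnear : measurable near_diagonal.
  rewrite (_ : near_diagonal = (fun z : V * V => enorm (z.2 - z.1)) @^-1`
      `]-oo, eps[%classic).
    by rewrite -[X in measurable X]setTI; exact: me.
  by apply/seteqP; split=> z /=; rewrite in_itv.
rewrite /strain_kernel; apply: measurable_funM.
  apply: measurable_funM; last first.
    under eq_fun do rewrite -surjective_pairing; exact: measurable_indic.
  by apply: measurable_funM; exact: measurableT_comp.
apply: measurable_funM => //; rewrite /kernel_weight; apply: measurable_funM.
  apply: measurable_funM => //.
  by apply: (measurableT_comp mJ); exact: measurable_funM.
apply: (measurableT_comp mg2); apply: measurable_funM.
  under eq_fun do rewrite -powR12_sqrt ?enorm_ge0//.
  by apply: (measurableT_comp (f := @powR R ^~ _)) => //; exact: measurable_powR.
under eq_fun do rewrite strainE.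
apply: measurable_funM => //; apply: measurable_dotp.
  by apply: measurable_cVB; exact: measurableT_comp.
exact: measurable_direction.
Qed.

Lemma strain_kernelE x y : Omega x -> Omega y -> enorm (y - x) < eps ->
  strain_kernel x y = kernel_weight J g eps y x u0 / enorm (y - x).
Proof.
move=> xO yO xy; rewrite /strain_kernel !indicE !mem_set// !mul1r.
by rewrite /kernel_weight /strain !cutoffE.
Qed.

Lemma strain_kernel_out x y : Omega x ->
  ~ (eball x eps `&` Omega) y -> strain_kernel x y = 0.
Proof.
move=> xO xy; rewrite /strain_kernel !indicE.
have [yO|yO] := pselect (Omega y); last by rewrite (memNset yO) mulr0 !mul0r.
by rewrite [(x, y) \in _]memNset ?mulr0 ?mul0r// => near; apply: xy.
Qed.

Lemma linearized_opE w x : Omega x ->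
  linearized_op Omega J g eps u0 w x =
  singular_op strain_kernel (cutoff Omega w) x.
Proof.
move=> xO; congr (- _); apply/colP => i; rewrite !mxE Rintegral_mkcond.
apply: eq_Rintegral => y _; rewrite patchE; case: ifPn => [/set_mem|/negP] yB.
  case: (yB) => yb yO; rewrite strain_kernelE// strainE !cutoffE//.
  by ring.
by rewrite strain_kernel_out ?mul0r// => /mem_set.
Qed.

Lemma stability_tensorE x : Omega x ->
  stability_tensor Omega J g eps u0 x = coupling strain_kernel x.
Proof.
move=> xO; apply/matrixP => i j; rewrite !mxE Rintegral_mkcond.
apply: eq_Rintegral => y _; rewrite patchE; case: ifPn => [/set_mem|/negP] yB.
  case: (yB) => yb yO; rewrite strain_kernelE// mxE big_ord_recl big_ord0 !mxE.
  by ring.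
by rewrite strain_kernel_out ?mul0r// => /mem_set.
Qed.

End kernel.

Lemma bounded_set_coord (R : realType) (d : nat) (A : set 'cV[R]_d) :
  bounded_set A -> exists N, forall x i, A x -> `|x i 0| <= N.
Proof.
move=> [N0 [_ AN]]; exists (N0 + 1) => x i Ax.
have /AN/(_ _ Ax) : N0 < N0 + 1 by rewrite ltrDl.
apply: le_trans; rewrite [leRHS]mx_normrE.
exact: (le_bigmax _ (fun ij => `|x ij.1 ij.2|) (i, 0)).
Qed.

Lemma bounded_set_finite_measure (R : realType) (d : nat) (A : set 'cV[R]_d) N :
  measurable A -> (forall x i, A x -> `|x i 0| <= N) ->
  (lebesgue_cV R d A < +oo)%E.
Proof.
move=> mA AN; pose b : 'cV[R]_d := const_mx `|N|.
apply: (@le_lt_trans _ _ (lebesgue_cV R d (cV_box (- b) b))).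
  apply: le_measure; rewrite ?inE//; first exact: measurable_cV_box.
  move=> x Ax i; rewrite !mxE -ler_norml (le_trans (AN x i Ax))//.
  exact: ler_norm.
by rewrite lebesgue_cV_box ?ltry// => i; rewrite !mxE ge0_cp.
Qed.

Lemma measurable_derivable (R : realType) (f : R -> R) :
  (forall r, derivable f r 1) -> measurable_fun [set: R] f.
Proof.
move=> df; apply: continuous_measurable_fun => r.
by apply: differentiable_continuous; exact/derivable1_diffP.
Qed.
(** * Invertibility excludes a degenerate coupling matrix *)

Lemma finite_uniform_bound (R : realType) (I : finType) (T : Type) (F : I -> T -> R) :
  (forall i, exists M, forall x, `|F i x| <= M) ->
  exists M, forall i x, `|F i x| <= M.
Proof.
move=> /choice[M FM]; exists (\sum_i `|M i|) => i x.
rewrite (bigD1 i)//= ler_wpDr ?sumr_ge0// (le_trans (FM i x))//.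
exact: ler_norm.
Qed.

Section degeneracy.
Context {R : realType} (d : nat).
Local Notation V := 'cV[R]_d.
Local Notation mu := (lebesgue_cV R d).
Hypothesis d2 : (2 <= d)%N.
Variables (Omega : set V) (N : R).
Hypotheses (mOmega : measurable Omega)
  (Omega_le : forall x i, Omega x -> `|x i 0| <= N).
Variables (a : V -> V -> R) (C : R) (T : (V -> V) -> V -> V).
Hypothesis C0 : 0 <= C.
Hypothesis ma : measurable_fun [set: V * V] (fun z : V * V => a z.1 z.2).
Hypothesis asym : forall x y, a x y = a y x.
Hypothesis a_le : forall x y,
  `|a x y| <= \1_Omega x * \1_Omega y * (C / enorm (y - x)).
Hypothesis TE : forall w x, Omega x -> T w x = singular_op a (cutoff Omega w) x.
Hypothesis Tinv : has_inverse_on_V Omega T.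

Let finOmega : (mu Omega < +oo)%E.
Proof. exact: bounded_set_finite_measure Omega_le. Qed.

Let degenerate : set V := Omega `&` [set x | \det (coupling a x) = 0].

Lemma measurable_degenerate : measurable degenerate.
Proof.
apply: measurableI => //.
have m : measurable_fun [set: V] (fun x => \det (coupling a x)).
  apply: measurable_sum => s; apply: measurable_funM => //.
  apply: measurable_prod => i _.
  exact: (measurable_coupling_entry d2 mOmega finOmega C0 ma a_le).
rewrite (_ : [set x | _] = (fun x => \det (coupling a x)) @^-1` [set 0])//.
by rewrite -[X in measurable X]setTI; exact: m.
Qed.

(** The two parts of T W, the product by the coupling matrix and the average,
    are bounded; and T is symmetric and kills rigid motions. *)
Lemma Vspace_image W : L6 W -> (forall x, ~ Omega x -> W x = 0) ->
  (exists M, forall x, norm1 (coupling a x *m W x) <= M) -> Vspace Omega (T W).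
Proof.
move=> WL6 WO [M AW].
have [M' KW] := finite_uniform_bound
  (fun i => averaging_coord_bounded d2 mOmega finOmega C0 ma a_le i WL6).
have cutW := cutoff_id WO.
have TW x : Omega x -> T W x = singular_op a W x by move=> xO; rewrite (TE _ xO) cutW.
split.
  apply: (@bounded_Linfty _ _ _ _ (M + \sum_(i < d) M')).
    have := measurable_singular_op d2 mOmega finOmega C0 ma a_le WL6.
    move/(measurable_funTS (D := Omega)).
    by apply: eq_measurable_fun => x /set_mem xO; rewrite TW.
  move=> x xO; rewrite TW// (singular_opE d2 mOmega finOmega C0 ma a_le)//.
  rewrite (le_trans (norm1B _ _))// lerD//.
  by apply: ler_sum => i _; exact: KW.
move=> rho [Q [c [Qskew ->]]]; pose r (x : V) := Q *m x + c; rewrite -/r.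
have rL : Linfty Omega r.
  rewrite /r; under eq_fun do rewrite affine_fieldE.
  exact: Linfty_affine Omega_le _.
rewrite Rintegral_cutoff.
transitivity (\int[mu]_x dotp (singular_op a W x) (cutoff Omega r x)).
  apply: eq_Rintegral => x _; have [xO|xO] := pselect (Omega x); first by rewrite TW.
  by rewrite cutoff_out// dotpC dotp0l dotpC dotp0l.
rewrite (singular_op_sym d2 mOmega finOmega C0 ma asym a_le WL6 (L6_cutoff mOmega finOmega rL)).
rewrite (_ : (fun x => _) = cst 0) ?Rintegral_cst ?mul0r//.
apply/funext => x; rewrite (singular_op_rigid a_le x Qskew (c := c)).
  by rewrite dotpC dotp0l.
by move=> y yO; rewrite cutoffE.
Qed.

(** As T is onto, psi is some T phi, and symmetry moves T from phi to h. *)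
Lemma kernel_annihilates_Vspace h : L6 h -> (\forall x \ae mu, singular_op a h x = 0) ->
  forall psi, Vspace Omega psi -> \int[mu]_x dotp (cutoff Omega psi x) (h x) = 0.
Proof.
move=> hL6 Th0 psi psiV; have [S [SV _ _ TS]] := Tinv.
have phiL6 := L6_cutoff mOmega finOmega (SV _ psiV).1.
have psiL6 := L6_cutoff mOmega finOmega psiV.1.
set phi := cutoff Omega (S psi) in phiL6.
have psiE : \forall x \ae mu, cutoff Omega psi x = singular_op a phi x.
  apply: filterS (TS _ psiV) => x Tx; have [xO|xO] := pselect (Omega x).
    by rewrite cutoffE// -(Tx xO) TE.
  by rewrite cutoff_out// (singular_op_out a_le).
have mT f : L6 f -> measurable_fun [set: V] (singular_op a f).
  by move=> fL6; exact: (measurable_singular_op d2 mOmega finOmega C0 ma a_le fL6).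
transitivity (\int[mu]_x dotp (singular_op a phi x) (h x)).
  congr fine; apply: ae_eq_integral => //.
  - by apply/measurable_EFinP; apply: measurable_dotp; [case: psiL6|case: hL6].
  - by apply/measurable_EFinP; apply: measurable_dotp; [exact: mT|case: hL6].
  - by apply: filterS psiE => x -> _.
rewrite (singular_op_sym d2 mOmega finOmega C0 ma asym a_le phiL6 hL6).
rewrite /Rintegral (ae_eq_integral (cst 0%E)) ?integral0//.
- by apply/measurable_EFinP; apply: measurable_dotp; [case: phiL6|exact: mT].
- by apply: filterS Th0 => x -> _; rewrite dotpC dotp0l.
Qed.

(** Otherwise exists_unbounded_field gives an unbounded W with T W in Vspace. The
    preimage v of T W is bounded, and v - W, killed by T, annihilates Vspace and
    is bounded too. *)
Lemma degenerate_null : mu degenerate = 0%E.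
Proof.
have mdeg := measurable_degenerate.
apply/eqP; rewrite eq_le measure_ge0 andbT leNgt; apply/negP => deg0.
have degO : degenerate `<=` Omega by move=> x [].
have degoo : (mu degenerate < +oo)%E.
  by apply: le_lt_trans finOmega; apply: le_measure; rewrite ?inE.
have [M AM] : exists M, forall x i j, `|coupling a x i j| <= M.
  have [M AM] := finite_uniform_bound (F := fun ij x => coupling a x ij.1 ij.2)
    (fun ij => coupling_entry_bounded d2 mOmega finOmega C0 ma a_le ij.1 ij.2).
  by exists M => x i j; exact: (AM (i, j)).
have [|W [mW Wdeg Woo AW Wlarge]] := exists_unbounded_field (ltnW d2)
  (measurable_coupling_entry d2 mOmega finOmega C0 ma a_le) AM mdeg deg0 degoo.
  move=> x [_ /= /eqP]; rewrite -det_tr => /det0P[v v0 vA].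
  exists v^T; split; first by rewrite -(inj_eq (can_inj (@trmxK _ _ _))) trmxK trmx0.
  by rewrite -[coupling a x]trmxK -trmx_mul vA trmx0.
have WL6 : L6 W by split.
have WO x : ~ Omega x -> W x = 0 by move=> xO; apply: Wdeg => -[].
have TWV : Vspace Omega (T W) by apply: Vspace_image => //; exists 1.
have [S [SV _ _ TS]] := Tinv.
have vV := SV _ TWV; set v := S (T W) in vV.
have vL6 := L6_cutoff mOmega finOmega vV.1.
have [M1 hM] : exists M, \forall x \ae mu, norm1 (cutoff Omega v x - W x) <= M.
  have hL6 := L6B vL6 WL6.
  apply: (Vspace_annihilator_bounded mOmega finOmega Omega_le hL6).
    by move=> x xO; rewrite cutoff_out// WO// subr0.
  apply: kernel_annihilates_Vspace => //.
  apply: filterS (TS _ TWV) => x Tx.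
  have [xO|xO] := pselect (Omega x); last exact: (singular_op_out a_le).
  rewrite (singular_opB d2 mOmega finOmega C0 ma a_le)// -TE// Tx// TE//.
  by rewrite (cutoff_id WO) subrr.
have [M2 [_ vM]] := Linfty_bounded vV.1.
have [F [mF FO F0 WF]] := Wlarge (M1 + M2 + 1).
have : mu.-negligible F.
  apply: (negligibleS _ (_ : mu.-negligible
      (~` [set x | norm1 (cutoff Omega v x - W x) <= M1 /\ (Omega x -> norm1 (v x) <= M2)]))).
    move=> x Fx [hx vx]; have xO := degO _ (FO _ Fx).
    have := WF _ Fx; have := vx xO; have := norm1B (v x) (cutoff Omega v x - W x).
    by rewrite cutoffE// subKr in hx *; lra.
  by apply: filterS2 hM vM => x hx vx; split.
move/(negligibleP mu mF) => F00.
by move: F0; rewrite F00 ltxx.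
Qed.

End degeneracy.
Theorem theorem6 (R : realType) (d : nat) (hd : d = 2%N \/ d = 3%N)
  (Omega : set 'cV[R]_d)
  (Omega_open : open Omega) (Omega_connected : connected Omega)
  (Omega_bounded : bounded_set Omega)
  (eps : R) (eps_gt0 : 0 < eps)
  (J : R -> R) (J_measurable : measurable_fun [set: R] J)
  (J_ge0 : forall r, 0 <= J r)
  (J_bounded : exists M, forall r, J r <= M)
  (J_supp : forall r, ~ (0 <= r <= 1) -> J r = 0)
  (g : R -> R)
  (g_derivable : forall k r, (k < 3)%N -> derivable g^`(k)%classic r 1)
  (g_C3 : continuous g^`(3)%classic)
  (g_bounded : forall k, (k <= 3)%N -> exists M, forall r, `|g^`(k)%classic r| <= M)
  (g0 : g 0 = 0) (g_gt0 : forall r, r != 0 -> 0 < g r)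
  (re rc : R) (re_lt0 : re < 0) (rc_gt0 : 0 < rc)
  (g_convex : convex_function `]re, rc[ g)
  (g_concave_left : convex_function `]-oo, re] (fun r => - g r))
  (g_concave_right : convex_function `[rc, +oo[ (fun r => - g r))
  (g_cvg_pinfty : cvg (g r @[r --> +oo]))
  (g_cvg_ninfty : cvg (g r @[r --> -oo]))
  (g2_max : forall r, `|g^`(2)%classic r| <= g^`(2)%classic 0)
  (u0 : 'cV[R]_d -> 'cV[R]_d) (u0_V : Vspace Omega u0)
  (inv : has_inverse_on_V Omega (linearized_op Omega J g eps u0)) :
  \forall x \ae lebesgue_cV R d, Omega x ->
    [set v : 'cV[R]_d | stability_tensor Omega J g eps u0 x *m v = 0] = [set 0].
Proof.
have d2 : (2 <= d)%N by case: hd => ->.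
have mOmega : measurable Omega by exact: open_measurable_cV.
have [N Omega_le] := bounded_set_coord Omega_bounded.
have [MJ J_le] := J_bounded; have [Mg g2_le] := g_bounded 2 isT.
have {}J_le r : `|J r| <= MJ by rewrite ger0_norm.
have mg2 : measurable_fun [set: R] (g^`(2)%classic).
  by apply: measurable_derivable => r; exact: g_derivable.
have u0_measurable : measurable_fun Omega u0 by have [[]] := u0_V.
have C0 := strain_kernel_cst_ge0 d eps J_le g2_le.
have null := degenerate_null d2 mOmega Omega_le C0
  (measurable_strain_kernel eps mOmega u0_measurable J_measurable mg2)
  (@strain_kernel_sym _ _ Omega J g eps u0)
  (strain_kernel_le Omega eps u0 J_le g2_le)
  (linearized_opE J g eps u0) inv.
exists (Omega `&` [set x | \det (coupling (strain_kernel Omega J g eps u0) x) = 0]).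
split=> //; first exact: (measurable_degenerate d2 mOmega Omega_le C0
    (measurable_strain_kernel eps mOmega u0_measurable J_measurable mg2)
    (strain_kernel_le Omega eps u0 J_le g2_le)).
move=> x nker; apply: contrapT => xdeg; apply: nker => xO.
rewrite stability_tensorE//; apply/seteqP; split=> v /=; last first.
  by move=> ->; rewrite mulmx0.
move=> Av; have unitA : coupling (strain_kernel Omega J g eps u0) x \in unitmx.
  by rewrite unitmxE unitfE; apply/eqP => detA; apply: xdeg.
by rewrite -[v](mulKmx unitA) Av mulmx0.
Qed.
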